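(* Let $(W,S)$ be an irreducible Coxeter system of arbitrary rank with Coxeter graph $\Gamma$, and let $H\lhd W$ be a normal subgroup generated by involutions. Then: (i) If $H\subset Z(W)$, then $Z_W(H)=W$. (ii) If $(W,S)=(W(B_n),S(B_n))$ with $2\leq n\leq\infty$, $\tau\in\mathrm{Aut}(\Gamma(B_n))$, $H\not\subset Z(W)$ and $H\subset\tau(G_{B_n})$, then $Z_W(H)=\tau(G_{B_n})$. (iii) If $(W,S)=(W(D_n),S(D_n))$ with $3\leq n\leq\infty$, $\tau\in\mathrm{Aut}(\Gamma(D_n))$, $H\not\subset Z(W)$ and $H\subset\tau(G_{D_n})$, then $Z_W(H)=\tau(G_{D_n})$. (iv) Otherwise, $Z_W(H)=Z(W)$.
   Context: A Coxeter system $(W,S)$ consists of a group $W$ with presentation $\langle S\mid (st)^{m(s,t)}=1 \text{ for } s,t\in S,\ m(s,t)<\infty\rangle$, where $m:S\times S\to\{1,2,\dots\}\cup\{\infty\}$ is symmetric and $m(s,t)=1$ iff $s=t$. $S$ may have arbitrary cardinality (the rank). The Coxeter graph has vertex set $S$ and an edge labelled $m(s,t)$ between $s,t$ whenever $m(s,t)\geq 3$. $(W,S)$ is irreducible if its Coxeter graph is connected. Coxeter systems are considered up to isomorphism of systems (isomorphism of Coxeter graphs). $Z_W(H)$ is the centralizer of $H$ in $W$ and $Z(W)$ the center. $(W(\mathcal{T}),S(\mathcal{T}))$ is the Coxeter system with graph $\Gamma(\mathcal{T})$. For $1\leq n\leq\infty$ the vertices of $\Gamma(B_n)$ and of $\Gamma(D_n)$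 are the $s_i$ with $1\leq i\leq n$, $i<\infty$. $\Gamma(B_n)$: edge $s_1s_2$ labelled $4$, edges $s_is_{i+1}$ ($i\geq 2$) labelled $3$. $\Gamma(D_n)$: edges $s_1s_3$, $s_2s_3$, $s_is_{i+1}$ ($i\geq 3$), all labelled $3$. For $k<n$, $S(B_k)$, resp. $S(D_k)$, denotes the subset $\{s_1,\dots,s_k\}$ of $S(B_n)$, resp. $S(D_n)$. The system of type $A_3$ is regarded as the system of type $D_3$ (their Coxeter graphs are isomorphic). For $I\subset S$ with parabolic subgroup $W_I=\langle I\rangle$ finite, $w_0(I)$ is the longest element of $W_I$. $G_{B_n}$ is the subgroup of $W(B_n)$ generated by all $w_0(S(B_i))$ with $1\leq i\leq n$, $i<\infty$. $G_{D_n}$ is the smallest normal subgroup of $W(D_n)$ containing all $w_0(S(D_{2k}))$ ($1\leq k<\infty$, $2k\leq n$); it equals the subgroup generated by all $w_0(S(D_i))$ with $2\leq i\leq n$, $i<\infty$. A graph automorphism $\tau\in\mathrm{Aut}(\Gamma)$ induces an automorphism of $W$ (permuting $S$), also denoted $\tau$. *)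

(* Defs.v *)
From HB Require Import structures.
From Stdlib Require Export Relation_Operators.
From mathcomp Require Export all_boot.
From mathcomp Require Export boolp classical_sets.

Set Implicit Arguments.
Unset Strict Implicit.
Unset Printing Implicit Defensive.

Local Open Scope classical_set_scope.
Local Open Scope group_scope.

(* Elements of {0, 1, 2, ...} U {oo} are encoded in [option nat], with
   [None] standing for oo. *)
Definition le_inf (k : nat) (n : option nat) : bool :=
  if n is Some p then (k <= p)%N else true.

Section Groups.
Variable W : groupType.
Implicit Types (A H K : set W).

Definition subgroup K : Prop :=
  [/\ K 1, (forall x y, K x -> K y -> K (x * y)) & (forall x, K x -> K x^-1)].

Definition normal_subgroup K : Prop :=
  subgroup K /\ forall x w, K x -> K (x ^ w).

Definition generated A : set W := smallest subgroup A.

Definition normal_closure A : set W := smallest normal_subgroup A.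

Definition centralizer H : set W := [set w | forall h, H h -> commute w h].

Definition center : set W := centralizer setT.

Definition involution (x : W) : Prop := x != 1 /\ x ^+ 2 = 1.

Definition generated_by_involutions H : Prop :=
  exists2 A : set W, A `<=` involution & H = generated A.

End Groups.

Arguments center : clear implicits.

(* The presentation of W is expressed by the universal property of
   <S | (st)^m(s,t) = 1>, the map [gen] being the canonical one from S to W.
   Its injectivity is a classical consequence. *)
Record coxeter_system (S : Type) (m : S -> S -> option nat)
    (W : groupType) (gen : S -> W) : Prop := CoxeterSystem {
  cox_sym : forall s t, m s t = m t s;
  cox_pos : forall s t, m s t <> Some 0%N;
  cox_diag : forall s t, m s t = Some 1%N <-> s = t;
  cox_rel : forall s t k, m s t = Some k -> (gen s * gen t) ^+ k = 1;
  cox_gen : generated (range gen) = setT;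
  cox_univ : forall (G : groupType) (u : S -> G),
    (forall s t k, m s t = Some k -> (u s * u t) ^+ k = 1) ->
    exists f : {multiplicative W -> G}, forall s, f (gen s) = u s
}.

Definition cox_edge (S : Type) (m : S -> S -> option nat) (s t : S) : Prop :=
  le_inf 3 (m s t).

Definition irreducible (S : Type) (m : S -> S -> option nat) : Prop :=
  forall s t : S, clos_refl_trans S (cox_edge m) s t.

Definition graph_iso (S S' : Type) (m : S -> S -> option nat)
    (m' : S' -> S' -> option nat) (phi : S -> S') : Prop :=
  [/\ bijective phi,
      (forall s t, cox_edge m' (phi s) (phi t) <-> cox_edge m s t)
    & (forall s t, cox_edge m s t -> m' (phi s) (phi t) = m s t)].

Section Length.
Variables (S : Type) (W : groupType) (gen : S -> W).

Definition word_val (r : seq S) : W := \prod_(s <- r) gen s.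

Definition reduced (r : seq S) : Prop :=
  forall r' : seq S, word_val r' = word_val r -> (size r <= size r')%N.

Definition cox_length (w : W) : nat :=
  xget 0%N [set size r | r in [set r | word_val r = w /\ reduced r]].

Definition parabolic (I : set S) : set W := generated (gen @` I).

(* Meaningful when [parabolic I] is finite, in which case the longest element
   exists and is unique. *)
Definition longest_elt (I : set S) : W :=
  xget 1 [set w | parabolic I w /\
                  forall v, parabolic I v -> (cox_length v <= cox_length w)%N].

End Length.

(* The vertices s_i, 1 <= i <= n, i < oo, of Gamma(B_n) and Gamma(D_n). *)
Definition vertex (n : option nat) : Type :=
  {i : nat | (1 <= i)%N && le_inf i n}.

Definition edgeB (i j : nat) : bool := (1 <= i)%N && (j == i.+1).

Definition matB (n : option nat) (x y : vertex n) : option nat :=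
  let i := val x in let j := val y in
  if i == j then Some 1%N
  else if edgeB i j || edgeB j i then
    (if minn i j == 1%N then Some 4%N else Some 3%N)
  else Some 2%N.

Definition edgeD (i j : nat) : bool :=
  ((i == 1%N) && (j == 3%N)) || ((2 <= i)%N && (j == i.+1)).

Definition matD (n : option nat) (x y : vertex n) : option nat :=
  let i := val x in let j := val y in
  if i == j then Some 1%N
  else if edgeD i j || edgeD j i then Some 3%N
  else Some 2%N.

(* The subset {s_1, ..., s_k}, that is S(B_k) or S(D_k). *)
Definition initial (n : option nat) (k : nat) : set (vertex n) :=
  [set x | (val x <= k)%N].

Arguments initial : clear implicits.

Section TypesBD.
Variables (S : Type) (W : groupType) (gen : S -> W).
Variables (n : option nat) (phi : vertex n -> S).

(* G_{B_n} and G_{D_n}, transported along an identification [phi] of the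
   vertices of Gamma(B_n), resp. Gamma(D_n), with S. *)
Definition GB : set W :=
  generated [set longest_elt gen (phi @` initial n k)
            | k in [set k | (1 <= k)%N && le_inf k n]].

Definition GD : set W :=
  normal_closure [set longest_elt gen (phi @` initial n k.*2)
                 | k in [set k | (1 <= k)%N && le_inf k.*2 n]].

(* [f] is the endomorphism of W induced by the vertex map [tau]. *)
Definition induced (tau : vertex n -> vertex n) (f : W -> W) : Prop :=
  forall i, f (gen (phi i)) = gen (phi (tau i)).

End TypesBD.

(* (W,S) is identified with the system of type B_n, 2 <= n <= oo, by [phi], and
   [f] is the automorphism of W induced by tau in Aut(Gamma(B_n)). *)
Definition typeB (S : Type) (m : S -> S -> option nat) (W : groupType)
    (gen : S -> W) (n : option nat) (phi : vertex n -> S)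
    (tau : vertex n -> vertex n) (f : {multiplicative W -> W}) : Prop :=
  [/\ le_inf 2 n, graph_iso (@matB n) m phi,
      graph_iso (@matB n) (@matB n) tau & induced gen phi tau f].

Definition typeD (S : Type) (m : S -> S -> option nat) (W : groupType)
    (gen : S -> W) (n : option nat) (phi : vertex n -> S)
    (tau : vertex n -> vertex n) (f : {multiplicative W -> W}) : Prop :=
  [/\ le_inf 3 n, graph_iso (@matD n) m phi,
      graph_iso (@matD n) (@matD n) tau & induced gen phi tau f].

(* Main.v *)
(* Let [W] act on the real vector space spanned by the simple roots, enlarged so
   that the invariant form becomes nondegenerate.  If [t] is an involution, [b] a
   root with [t b <> b, - b], and [k] commutes with [t] and with its conjugate by
   the reflection in [b], then [k] commutes with the product of the reflections
   in [b] and [t b], hence preserves the plane they span, and comparing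
   coefficients there gives [k b = b, - b, t b] or [- t b].  Applied to
   [t] in [H] and [k] in [Z_W(H)], both noncentral, this shows that each root is a
   sum of at most two simultaneous eigenvectors of [H] (or of [Z_W(H)]).  The
   simultaneous eigenspaces are orthogonal and permuted by [W]; since a
   reflection moving such a space has a one-dimensional (-1)-eigenspace, they are
   lines, and the roots have the form [+- e_i +- e_j] or [+- sqrt 2 e_i] in an
   orthonormal basis of them.  The Coxeter graph is then read off by walking away
   from a simple root [sqrt 2 e_1] (type B) or a pair [e_2 +- e_1] (type D), and
   [G_{B_n}], [G_{D_n}] are the groups of sign changes belonging to [W]. *)

Require Import Defs.
From HB Require Import structures.
From mathcomp Require Import all_order all_algebra.
From mathcomp Require Import all_classical all_reals all_analysis.
From mathcomp Require Import ring lra zify.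
From mathcomp Require Rstruct.

Set Implicit Arguments.
Unset Strict Implicit.
Unset Printing Implicit Defensive.

Import Order.TTheory GRing.Theory Num.Theory.
Local Open Scope ring_scope.

(** * Chebyshev polynomials at the Coxeter angles *)

(** Nondegeneracy matters because in affine types two roots can pair equally with all roots without
    being proportional; the added vectors still separate them. The product [t (r t r)], with [r] the
    reflection in [b], equals [(t r t) r], the product of the reflections in [t b] and [b], and this
    is where [t^2 = 1] enters. The obstacle is that Z_W(H) need not be generated by involutions, so
    H and Z_W(H) are not interchangeable. If some root is a simultaneous eigenvector of a normal
    subgroup, the reflection in it commutes with the whole subgroup and takes the part of [k]; this
    works for H and Z_W(H) alike. If neither has such a root, some element of Z_W(H) properly moves
    any given root, and involutions generating H serve as [t]. Longest elements are defined through
    word length, whence the detour over positive roots: an element of W_I that negates the simple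
    roots of I must be w_0(I). *)

Section Chebyshev.
Variable R : realType.

(* [cheb c n.+1] is the Chebyshev polynomial of the second kind [U_n] at
   [c / 2]. *)
Fixpoint cheb2 (c : R) (n : nat) : R * R :=
  if n is k.+1 then let: (a, b) := cheb2 c k in (b, c * b - a) else (0, 1).
Definition cheb c n := (cheb2 c n).1.

Lemma cheb0 c : cheb c 0 = 0. Proof. by []. Qed.
Lemma cheb1 c : cheb c 1 = 1. Proof. by []. Qed.
Lemma chebSS c n : cheb c n.+2 = c * cheb c n.+1 - cheb c n.
Proof. by rewrite /cheb /=; case: (cheb2 c n). Qed.

Lemma cheb_sin (x : R) n : cheb (2 * cos x) n * sin x = sin (n%:R * x).
Proof.
suff: cheb (2 * cos x) n * sin x = sin (n%:R * x) /\
  cheb (2 * cos x) n.+1 * sin x = sin (n.+1%:R * x) by case.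
elim: n => [|n [IH1 IH2]].
  by rewrite cheb0 cheb1 !mul0r sin0 !mul1r.
split=> //; rewrite chebSS mulrBl -[_ * cheb _ _ * _]mulrA IH1 IH2.
have -> : n.+2%:R * x = n.+1%:R * x + x by rewrite -[n.+2]addn1 natrD; ring.
have -> : n%:R * x = n.+1%:R * x - x by rewrite -[n.+1]addn1 natrD; ring.
by rewrite sinB sinD; ring.
Qed.

Lemma cheb2E n : cheb 2 n = n%:R.
Proof.
suff: cheb 2 n = n%:R /\ cheb 2 n.+1 = n.+1%:R by case.
elim: n => [|n [IH1 IH2]] //; split=> //.
by rewrite chebSS IH1 IH2 -[n.+2]addn1 -[n.+1]addn1 !natrD; ring.
Qed.

(* [mcoef k] is minus the product of two simple roots of squared length 2
   with relation exponent [k]. *)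
Definition mcoef (k : option nat) : R :=
  if k is Some m then 2 * cos (pi / m%:R) else 2.

Lemma mcoef1 : mcoef (Some 1%N) = - 2.
Proof. by rewrite /= divr1 cospi mulrN1. Qed.

Section Finite.
Variable m : nat.
Hypothesis m2 : (2 <= m)%N.
Let x : R := pi / m%:R.
Let m0 : (0 : R) < m%:R.
Proof. by rewrite ltr0n; lia. Qed.
Let x_gt0 : 0 < x.
Proof. by rewrite divr_gt0 ?pi_gt0. Qed.
Let mx : m%:R * x = pi.
Proof. by rewrite mulrC divfK ?gt_eqF. Qed.
Let x_le : x <= pi / 2.
Proof. by rewrite ler_pM2l ?pi_gt0// lef_pV2 ?posrE// (ler_nat _ 2). Qed.
Let sx : 0 < sin x.
Proof. by apply: sin_gt0_pi; rewrite x_gt0; have := @pi_gt0 R; have := x_le; lra. Qed.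

Lemma cheb_mcoef_gt0 n : (0 < n < m)%N -> 0 < cheb (mcoef (Some m)) n.
Proof.
move=> /andP[n0 nm]; rewrite -(pmulr_lgt0 _ sx) cheb_sin.
apply: sin_gt0_pi; rewrite mulr_gt0 ?ltr0n//= -[ltRHS]mx ltr_pM2r//.
by rewrite ltr_nat.
Qed.

Lemma cheb_mcoef_m : cheb (mcoef (Some m)) m = 0.
Proof.
apply: (mulIf (lt0r_neq0 sx)); rewrite mul0r cheb_sin mx sinpi //.
Qed.

(** The initial values 0 and 1 recur after 2m letters, which yields the Coxeter relation on the
    plane of two simple roots. *)
Lemma cheb_mcoef_period : cheb (mcoef (Some m)) (m + m) = 0 /\
  cheb (mcoef (Some m)) (m + m).+1 = 1.
Proof.
split; apply: (mulIf (lt0r_neq0 sx)); rewrite cheb_sin.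
  by rewrite natrD mulrDl mx sinDpi sinpi oppr0 mul0r.
have -> : (m + m).+1%:R * x = x + pi + pi.
  by rewrite -natr1 natrD -[in RHS]mx; ring.
by rewrite !sinDpi opprK mul1r.
Qed.

Lemma mcoef_bounds : 0 <= mcoef (Some m) < 2.
Proof.
have := cos_ge0_pihalf (x := x); have px := @pi_gt0 R; have xl := x_le.
have -> : mcoef (Some m) = 2 * cos x by [].
move=> h; apply/andP; split.
  by rewrite pmulr_rge0// h//; have := x_gt0; lra.
rewrite -ltr_pdivlMl// mulVf ?pnatr_eq0// -(@cos0 R) ltr_cos ?x_gt0//.
  by rewrite in_itv /= lexx ltW.
by rewrite in_itv /= ltW //; lra.
Qed.

End Finite.

Lemma mcoef_ge0 k : k <> Some 0%N -> k <> Some 1%N -> 0 <= mcoef k.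
Proof.
case: k => [[|[|m]]|] // _ _.
by have /andP[] := @mcoef_bounds m.+2 isT.
Qed.

(** These numbers are the coefficients of dihedral roots along alternating words that are not longer
    than the exponent. *)
Lemma cheb_mcoef_ge0 k n : k <> Some 0%N -> k <> Some 1%N ->
  (if k is Some m then (n <= m)%N else true) -> 0 <= cheb (mcoef k) n.
Proof.
case: k => [[|[|m]]|] // _ _; last by move=> _; rewrite /= cheb2E.
case: n => [|n] nm; first by rewrite cheb0.
have [->|nm'] := eqVneq n.+1 m.+2; first by rewrite cheb_mcoef_m.
by rewrite ltW// cheb_mcoef_gt0//; lia.
Qed.

Lemma cheb_2 c : cheb c 2 = c. Proof. by rewrite chebSS cheb1 cheb0; ring. Qed.
Lemma cheb_3 c : cheb c 3 = c ^+ 2 - 1.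
Proof. by rewrite chebSS cheb_2 cheb1; ring. Qed.
Lemma cheb_4 c : cheb c 4 = c * (c ^+ 2 - 2).
Proof. by rewrite chebSS cheb_2 cheb_3; ring. Qed.

Lemma mcoef2 : mcoef (Some 2%N) = 0.
Proof. by have := @cheb_mcoef_m 2 isT; rewrite cheb_2. Qed.

Lemma mcoef3 : mcoef (Some 3%N) = 1.
Proof.
have /andP[c0 _] := @mcoef_bounds 3 isT.
by have := @cheb_mcoef_m 3 isT; rewrite cheb_3; nra.
Qed.

Lemma mcoef4 : mcoef (Some 4%N) ^+ 2 = 2.
Proof.
have c0 := @cheb_mcoef_gt0 4 isT 2 isT; rewrite cheb_2 in c0.
have := @cheb_mcoef_m 4 isT; rewrite cheb_4 => /eqP.
by rewrite mulf_eq0 gt_eqF//= subr_eq0 => /eqP.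
Qed.

(** The exponent is the place of the first positive zero of [cheb c]: the values before it are
    positive, and for the infinite exponent [cheb 2 n = n] has no such zero. *)
Lemma mcoef_eq k n : k <> Some 0%N -> k <> Some 1%N -> (2 <= n <= 4)%N ->
  mcoef k = mcoef (Some n) -> k = Some n.
Proof.
move=> k0 k1 n24; have {}n24 : n \in [:: 2; 3; 4]%N by rewrite !inE; lia.
have n0 : (2 <= n)%N by move: n24; rewrite !inE; lia.
move=> kn; have := cheb_mcoef_m n0; rewrite -kn.
case: k k0 k1 kn => [m k0 k1 kn|_ _ _]; last first.
  by rewrite /= cheb2E => /eqP; rewrite pnatr_eq0; lia.
have m2 : (2 <= m)%N by case: m k0 k1 kn => [|[|]].
have [nm|nm|-> //] := ltngtP n m.
  by have := @cheb_mcoef_gt0 m m2 n; rewrite nm andbT => /(_ (ltnW n0)) + h2; rewrite h2 ltxx.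
have := @cheb_mcoef_gt0 n n0 m; rewrite nm andbT => /(_ (ltnW m2)).
by rewrite -kn cheb_mcoef_m// ltxx.
Qed.

End Chebyshev.

Arguments mcoef : simpl never.

(** * Free modules *)

(* The free module on [A] is realised as the space of evaluation functionals on
   [A -> R], so that a linear functional given by its values [g] on the basis
   is evaluated at [x] as [ev x g]. *)
Section FreeModule.
Variables (R : realType) (A : choiceType).

Definition is_comb (x : (A -> R) -> R^o) : bool :=
  `[< exists l : seq (R * A), forall g, x g = \sum_(c <- l) c.1 * g c.2 >].

Definition comb : {pred ((A -> R) -> R^o)} := is_comb.

Lemma comb_submod : submod_closed comb.
Proof.
split=> [|a x y /asboolP[l xl] /asboolP[l' yl]]; apply/asboolP.
  by exists [::] => g; rewrite big_nil.
exists ([seq (a * c.1, c.2) | c <- l] ++ l') => g.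
rewrite big_cat big_map/= -yl; congr (_ + _).
have -> : (a *: x) g = a * x g by [].
by rewrite xl mulr_sumr; apply: eq_bigr => c _; rewrite mulrA.
Qed.

HB.instance Definition _ := GRing.isSubmodClosed.Build R _ comb comb_submod.

Record free := Free { ev_fun : (A -> R) -> R^o ; _ : ev_fun \in comb }.
HB.instance Definition _ := [isSub for ev_fun].
HB.instance Definition _ := [Choice of free by <:].
HB.instance Definition _ := [SubChoice_isSubLmodule of free by <:].
End FreeModule.

Section FreeModuleTheory.
Variables (R : realType) (A : choiceType).
Local Notation free := (free R A).

Definition ev (x : free) (g : A -> R) : R := ev_fun x g.

Lemma free_eq (x y : free) : (forall g, ev x g = ev y g) -> x = y.
Proof. by move=> xy; apply/val_inj/funext. Qed.

Lemma ev0 g : ev 0 g = 0. Proof. by []. Qed.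
Lemma evD x y g : ev (x + y) g = ev x g + ev y g. Proof. by []. Qed.
Lemma evN x g : ev (- x) g = - ev x g. Proof. by []. Qed.
Lemma evZ a x g : ev (a *: x) g = a * ev x g. Proof. by []. Qed.
Definition evE := (ev0, evD, evN, evZ).

Lemma bas_subproof a : (fun g : A -> R => g a : R^o) \in @comb R A.
Proof.
by apply/asboolP; exists [:: (1, a)] => g; rewrite big_seq1 mul1r.
Qed.
Definition bas a : free := @Free R A _ (bas_subproof a).

Lemma free_seq x : exists2 l : seq A, uniq l &
  exists c : A -> R, forall g, ev x g = \sum_(a <- l) c a * g a.
Proof.
have /asboolP[l xl] := valP x.
exists (undup (map snd l)); first exact: undup_uniq.
exists (fun a => \sum_(c <- l | c.2 == a) c.1) => g.
under eq_bigr do rewrite mulr_suml.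
rewrite (exchange_big_dep predT)//= [LHS]xl.
rewrite big_seq [RHS]big_seq; apply: eq_bigr => c cl.
rewrite -big_filter (eq_filter (a2 := pred1 c.2)); last first.
  by move=> a /=; rewrite eq_sym.
by rewrite filter_pred1_uniq ?undup_uniq ?big_seq1// mem_undup map_f.
Qed.

Definition coord (x : free) (a : A) : R := ev x (fun b => (b == a)%:R).

Lemma coord_bas a b : coord (bas a) b = (a == b)%:R. Proof. by []. Qed.

Lemma coordD x y a : coord (x + y) a = coord x a + coord y a. Proof. by []. Qed.
Lemma coordN x a : coord (- x) a = - coord x a. Proof. by []. Qed.
Lemma coordZ k x a : coord (k *: x) a = k * coord x a. Proof. by []. Qed.

Lemma ev_ge0 x g : (forall a, 0 <= coord x a * g a) -> 0 <= ev x g.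
Proof.
have [l ul [c xE]] := free_seq x.
have cE a : coord x a = if a \in l then c a else 0.
  rewrite /coord xE; case: ifPn => al.
    rewrite (bigD1_seq a)//= eqxx mulr1 big1 ?addr0// => b /negPf ->.
    by rewrite mulr0.
  rewrite big_seq big1// => b bl; case: eqP => [ba|]; last by rewrite mulr0.
  by rewrite -ba bl in al.
move=> h; rewrite xE big_seq sumr_ge0// => a al.
by have := h a; rewrite cE al.
Qed.

Lemma ev_oppr x g : ev x (fun a => - g a) = - ev x g.
Proof.
have [l ul [c xE]] := free_seq x.
by rewrite !xE -sumrN; apply: eq_bigr => a _; rewrite mulrN.
Qed.

Lemma ev_add x g h : ev x (fun a => g a + h a) = ev x g + ev x h.
Proof.
have [l ul [c xE]] := free_seq x.
by rewrite !xE -big_split; apply: eq_bigr => a _; rewrite mulrDr.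
Qed.

Lemma ev_scale x k g : ev x (fun a => k * g a) = k * ev x g.
Proof.
have [l ul [c xE]] := free_seq x.
by rewrite !xE mulr_sumr; apply: eq_bigr => a _; rewrite mulrCA.
Qed.

(** The difference and its opposite are both nonnegative by [ev_ge0], so no supports have to be
    compared. *)
Lemma ev_eq x g h : (forall a, coord x a = 0 \/ g a = h a) -> ev x g = ev x h.
Proof.
move=> gh; apply/eqP; rewrite -subr_eq0 -ev_oppr -ev_add eq_le -oppr_ge0 -ev_oppr.
by rewrite !ev_ge0// => a; case: (gh a) => ->; rewrite ?mul0r// subrr ?oppr0 mulr0.
Qed.

Lemma coord_eq0 x : (forall a, coord x a = 0) -> x = 0.
Proof.
move=> x0; apply/free_eq => g; rewrite ev0 (@ev_eq _ _ (fun a => 0 * g a)).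
  by rewrite ev_scale mul0r.
by move=> a; left.
Qed.

Lemma free_ind (P : free -> Prop) : P 0 ->
  (forall k a x, P x -> P (k *: bas a + x)) -> forall x, P x.
Proof.
move=> P0 PS x; have [l _ [c xE]] := free_seq x.
have -> : x = \sum_(a <- l) c a *: bas a.
  apply/free_eq => g; rewrite xE.
  by elim/big_rec2: _ => [|a y1 y2 _ ->]; rewrite ?ev0// evD evZ.
by elim: l {xE} => [|a l IH]; rewrite ?big_nil// big_cons; apply: PS.
Qed.

Variable M : A -> A -> R.
Hypothesis Msym : forall a b, M a b = M b a.

Definition form (x y : free) : R := ev x (fun a => ev y (M a)).

Lemma form0l x : form 0 x = 0. Proof. by []. Qed.
Lemma formDl x y z : form (x + y) z = form x z + form y z. Proof. by []. Qed.
Lemma formZl k x z : form (k *: x) z = k * form x z. Proof. by []. Qed.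
Lemma form_bas a y : form (bas a) y = ev y (M a). Proof. by []. Qed.

(** Linearity in the first argument holds by definition; symmetry carries it over to the second. *)
Lemma formC x y : form x y = form y x.
Proof.
elim/free_ind: x => [|k a x IH].
  by rewrite form0l /form (@ev_eq _ _ (fun a => 0 * 0)) ?ev_scale ?mul0r// => a; right.
rewrite formDl formZl IH {2 3}/form.
rewrite -[RHS]/(ev y (fun b => k * M b a + ev x (M b))) ev_add ev_scale.
by congr (_ * _ + _); rewrite form_bas; congr ev; apply/funext => b.
Qed.

End FreeModuleTheory.

Arguments ev : simpl never.
Arguments coord : simpl never.
Arguments form : simpl never.

(** * The geometric representation *)

Section Bijections.
Variable T : Type.

(** The universal property wants a group as target. All bijections of a set serve, linearity of the
    action being recovered afterwards by induction on words; storing the inverse makes the group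
    operations explicit. *)
Record bij := Bij {
  bij_fun : T -> T; bij_inv : T -> T;
  bij_funK : cancel bij_fun bij_inv; bij_invK : cancel bij_inv bij_fun }.

Lemma bij_eq (f g : bij) : bij_fun f =1 bij_fun g -> f = g.
Proof.
case: f g => [f f' fK f'K] [g g' gK g'K] /= /funext fg.
have f'g' : f' = g' by apply/funext => x; rewrite -[LHS]gK -fg f'K.
by subst; congr Bij; apply: Prop_irrelevance.
Qed.

HB.instance Definition _ := gen_eqMixin bij.
HB.instance Definition _ := gen_choiceMixin bij.

Definition bij_one := @Bij id id (fun _ => erefl) (fun _ => erefl).
Definition bij_opp (f : bij) := Bij (@bij_invK f) (@bij_funK f).
Definition bij_mul (f g : bij) :=
  Bij (can_comp (@bij_funK f) (@bij_funK g)) (can_comp (@bij_invK g) (@bij_invK f)).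

Lemma bij_mulA : associative bij_mul. Proof. by move=> f g h; apply: bij_eq. Qed.
Lemma bij_mul1 : left_id bij_one bij_mul. Proof. by move=> f; apply: bij_eq. Qed.
Lemma bij_mulr1 : right_id bij_one bij_mul. Proof. by move=> f; apply: bij_eq. Qed.
Lemma bij_mulV : left_inverse bij_one bij_opp bij_mul.
Proof. by move=> f; apply: bij_eq => x /=; rewrite bij_funK. Qed.
Lemma bij_mulrV : right_inverse bij_one bij_opp bij_mul.
Proof. by move=> f; apply: bij_eq => x /=; rewrite bij_invK. Qed.

HB.instance Definition _ :=
  isGroup.Build bij bij_mulA bij_mul1 bij_mulr1 bij_mulV bij_mulrV.

Lemma bij_funM (f g : bij) : bij_fun (f * g)%g = bij_fun f \o bij_fun g.
Proof. by []. Qed.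
Lemma bij_funX (f : bij) n : bij_fun (f ^+ n)%g =1 iter n (bij_fun f).
Proof. by elim: n => [|n IH] x //; rewrite expgS bij_funM /= IH. Qed.

End Bijections.

Ltac vring := apply: free_eq => ?; rewrite ?evE; ring.

Section GeometricSpace.
Variables (R : realType) (S : Type) (m : S -> S -> option nat).
Hypothesis m_sym : forall s t, m s t = m t s.
Hypothesis m_pos : forall s t, m s t <> Some 0%N.
Hypothesis m_diag : forall s t, m s t = Some 1%N <-> s = t.

(* The vectors [inr s] are dual to the simple roots [inl s]: they make the
   form nondegenerate whatever the Coxeter matrix is. *)
Definition gram (a b : {classic (S + S)}) : R :=
  match a : S + S, b : S + S with
  | inl s, inl t => - mcoef R (m s t)
  | inl s, inr t | inr s, inl t => `[< s = t >]%:R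
  | inr _, inr _ => 0
  end.

Local Notation space := (free R {classic (S + S)}).

Definition root (s : S) : space := bas R (inl s : {classic (S + S)}).
Definition coroot (s : S) : space := bas R (inr s : {classic (S + S)}).
Definition bform (x y : space) : R := form gram x y.
Definition reflection (b x : space) : space := x - bform x b *: b.

Lemma gram_sym a b : gram a b = gram b a.
Proof.
by case: a b => s [t|t] //=; rewrite 1?m_sym//; congr (_%:R); congr nat_of_bool;
  apply/asboolP/asboolP.
Qed.

Lemma fmC x y : bform x y = bform y x. Proof. exact/formC/gram_sym. Qed.
Lemma fm0l x : bform 0 x = 0. Proof. by []. Qed.
Lemma fmDl x y z : bform (x + y) z = bform x z + bform y z. Proof. by []. Qed.
Lemma fmNl x z : bform (- x) z = - bform x z. Proof. by []. Qed.
Lemma fmZl k x z : bform (k *: x) z = k * bform x z. Proof. by []. Qed.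
Lemma fm0r x : bform x 0 = 0. Proof. by rewrite fmC. Qed.
Lemma fmDr z x y : bform z (x + y) = bform z x + bform z y.
Proof. by rewrite !(fmC z). Qed.
Lemma fmNr z x : bform z (- x) = - bform z x. Proof. by rewrite !(fmC z). Qed.
Lemma fmZr k z x : bform z (k *: x) = k * bform z x. Proof. by rewrite !(fmC z). Qed.
Definition fmE := (fmDl, fmNl, fmZl, fm0l, fmDr, fmNr, fmZr, fm0r).

Lemma fm_root s t : bform (root s) (root t) = - mcoef R (m s t). Proof. by []. Qed.
Lemma fm_root2 s : bform (root s) (root s) = 2.
Proof.
by rewrite fm_root; have /m_diag -> : s = s by []; rewrite mcoef1 opprK.
Qed.

(** Pairing with [coroot s] reads off the coordinate at [root s]; once these vanish, pairing with
    [root s] reads off the coordinate at [coroot s]. *)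
Lemma fm_inj x y : (forall z, bform x z = bform y z) -> x = y.
Proof.
move=> xy; suff z0 z : (forall v, bform z v = 0) -> z = 0.
  by apply/eqP; rewrite -subr_eq0; apply/eqP/z0 => v; rewrite !fmE xy subrr.
move=> z0.
have zs s : coord z (inl s : {classic (S + S)}) = 0.
  rewrite -(z0 (coroot s)) /bform formC; last exact: gram_sym.
  rewrite form_bas /coord; congr ev; apply/funext => -[] t /=; last by case: eqP.
  by congr (_%:R); congr nat_of_bool; apply/eqP/asboolP => [[->]|->].
apply: coord_eq0 => -[] s //.
rewrite -(z0 (root s)) /bform formC; last exact: gram_sym.
rewrite form_bas /coord; apply: ev_eq => -[] t; first by left; apply: zs.
right; congr (_%:R); congr nat_of_bool.
by apply/eqP/asboolP => [[->]|->].
Qed.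

Lemma refl_root b : bform b b = 2 -> reflection b b = - b.
Proof. by move=> bb; rewrite /reflection bb; vring. Qed.

Lemma reflK b : bform b b = 2 -> involutive (reflection b).
Proof. by move=> bb x; rewrite /reflection !fmE bb; vring. Qed.

Lemma fm_refl b x y : bform b b = 2 -> bform (reflection b x) (reflection b y) = bform x y.
Proof. by move=> bb; rewrite /reflection !fmE bb (fmC b y); ring. Qed.

Lemma refl_lin b k x y : reflection b (k *: x + y) = k *: reflection b x + reflection b y.
Proof. by rewrite /reflection !fmE; vring. Qed.

(* The letter number [j] from the right of the alternating word (... s t). *)
Definition letter (s t : S) (j : nat) := if odd j then s else t.

Fixpoint altrefl (s t : S) (j : nat) (x : space) : space :=
  if j is i.+1 then reflection (root (letter s t i)) (altrefl s t i x) else x.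

(** Each further letter acts on the pair of coefficients by the Chebyshev recurrence. The rightmost
    letter, number 0, is [t]. *)
Lemma altrefl_root s t j : let c := mcoef R (m s t) in
  altrefl s t j (root s) = cheb c j.+1 *: root (letter s t j.+1) +
                           cheb c j *: root (letter s t j).
Proof.
move=> c; elim: j => [|j IH]; first by rewrite cheb0 cheb1 /letter /=; vring.
rewrite [altrefl _ _ _ _]/= IH chebSS /c /letter /=.
by case: (odd j); rewrite /= /reflection !fmE !fm_root2 fm_root ?(m_sym t s); vring.
Qed.

Lemma altrefl_double s t j x :
  altrefl s t j.*2 x = iter j (reflection (root s) \o reflection (root t)) x.
Proof.
by elim: j => [|j IH] //; rewrite doubleS /= -IH /letter /= odd_double.
Qed.

Lemma iter_refl_root s t k : m s t = Some k ->
  iter k (reflection (root s) \o reflection (root t)) (root s) = root s.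
Proof.
case: k => [/m_pos //|[|k]] st.
  by rewrite /= (m_diag s t).1// reflK ?fm_root2.
rewrite -altrefl_double altrefl_root st -addnn.
have [-> ->] := @cheb_mcoef_period R k.+2 isT.
by rewrite /letter oddS addnn odd_double; vring.
Qed.

Lemma refl_order s t k : m s t = Some k -> forall x,
  iter k (reflection (root s) \o reflection (root t)) x = x.
Proof.
move=> st x; have [k1|k1] := eqVneq k 1%N.
  by move: st; rewrite k1 => /m_diag ->; rewrite /= reflK ?fm_root2.
have k2 : (2 <= k)%N by case: k k1 st => [|[]] // _ /m_pos.
set f := _ \o _.
have fs : iter k f (root s) = root s by apply: iter_refl_root.
have ft : iter k f (root t) = root t.
  (* The reflections in the opposite order form the inverse of [f], whose [k]-th iterate fixes
     [root t]; hence so does that of [f]. *)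
  have := @iter_refl_root t s k; rewrite m_sym => /(_ st) {1}<-.
  elim: k {st k1 k2 fs} => [|k IH] //.
  rewrite iterSr iterS -[RHS]IH; congr iter.
  by rewrite /f /= !reflK ?fm_root2.
have flin a y z : iter k f (a *: y + z) = a *: iter k f y + iter k f z.
  by elim: k {st k1 k2 fs ft} => [|k IH] //=; rewrite IH /f /= !refl_lin.
have /andP[c0 c2] := @mcoef_bounds R k k2.
set c := mcoef R _ in c0 c2.
(* the plane of the two roots is nondegenerate, so that [x] is the sum of a
   vector in this plane and a vector fixed by both reflections *)
pose d := 4 - c ^+ 2.
have d0 : d != 0 by rewrite /d subr_eq0 gt_eqF//; nra.
pose p := bform x (root s); pose q := bform x (root t).
pose a := (2 * p + c * q) / d; pose b := (2 * q + c * p) / d.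
pose z := x - a *: root s - b *: root t.
have ap : 2 * a - c * b = p by rewrite /a /b; move: (d0); rewrite /d => ?; field.
have bq : 2 * b - c * a = q by rewrite /a /b; move: (d0); rewrite /d => ?; field.
have zs : bform z (root s) = 0.
  by rewrite !fmE fm_root2 fm_root (m_sym t s) st -/c -/p -ap; ring.
have zt : bform z (root t) = 0.
  by rewrite !fmE fm_root2 fm_root st -/c -/q -bq; ring.
have fz : iter k f z = z.
  elim: k {st k1 k2 c c0 c2 d d0 a b ap bq fs ft flin} z zs zt => [|k IH] z zs zt //.
  rewrite iterSr; have -> : f z = z; last by rewrite IH.
  by rewrite /f /= /reflection zt scale0r subr0 zs scale0r subr0.
have -> : x = a *: root s + (b *: root t + z) by rewrite /z; vring.
by rewrite !flin fs ft fz.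
Qed.

End GeometricSpace.

Arguments bform : simpl never.
Arguments reflection : simpl never.
Arguments root : simpl never.
Arguments coroot : simpl never.

(** * Words and length *)

Section Subgroups.
Variable W : groupType.
Implicit Types (A K : set W).

Lemma generated_subgroup A : subgroup (generated A).
Proof.
split=> [K [[]]//|x y Ax Ay K KA|x Ax K KA].
  by have [[_ KM _] _] := KA; apply: KM; [apply: Ax|apply: Ay].
by have [[_ _ KV] _] := KA; apply: KV; apply: Ax.
Qed.

Lemma sub_generated A x : A x -> generated A x.
Proof. by move=> Ax K [_]; apply. Qed.

Lemma generated_ind A (P : W -> Prop) : P 1%g ->
  (forall x y, P x -> P y -> P (x * y)%g) -> (forall x, P x -> P x^-1%g) ->
  (forall x, A x -> P x) -> forall x, generated A x -> P x.
Proof. by move=> P1 PM PV PA x /(_ P); apply. Qed.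

Lemma normal_closure_normal A : normal_subgroup (normal_closure A).
Proof.
split; first split=> [K [[[]]]//|x y Ax Ay K KA|x Ax K KA].
- by have [[[_ KM _] _] _] := KA; apply: KM; [apply: Ax|apply: Ay].
- by have [[[_ _ KV] _] _] := KA; apply: KV; apply: Ax.
by move=> x w Ax K KA; have [[_ KJ] _] := KA; apply: KJ; apply: Ax.
Qed.

Lemma sub_normal_closure A x : A x -> normal_closure A x.
Proof. by move=> Ax K [_]; apply. Qed.

End Subgroups.

Section CoxeterSystem.
Variables (R : realType) (S : Type) (m : S -> S -> option nat).
Variables (W : groupType) (gen : S -> W).
Hypothesis WS : coxeter_system m gen.

Let m_sym := cox_sym WS.
Let m_pos := cox_pos WS.
Let m_diag := cox_diag WS.

Local Notation space := (free R {classic (S + S)}).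
Local Notation root := (root R).
Local Notation fm := (bform (R := R) m).
Local Notation refl := (reflection (R := R) m).

Lemma gen_sq s : (gen s * gen s = 1)%g.
Proof.
by have /m_diag/(cox_rel WS) : s = s by [].
Qed.

Lemma genV s : (gen s)^-1%g = gen s.
Proof. exact/mulg1_eq/gen_sq. Qed.

Lemma refl_rootK s : involutive (refl (root s)).
Proof. exact/reflK/fm_root2. Qed.

Lemma rep_subproof : exists f : {multiplicative W -> bij space},
  forall s, f (gen s) = Bij (@refl_rootK s) (@refl_rootK s).
Proof.
apply: (cox_univ WS) => s t k st; apply: bij_eq => x.
rewrite bij_funX; exact: refl_order.
Qed.

Definition rho (w : W) : space -> space := bij_fun (sval (cid rep_subproof) w).

Lemma rho_gen s x : rho (gen s) x = refl (root s) x.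
Proof. by rewrite /rho (svalP (cid rep_subproof)). Qed.

Lemma rhoM v w x : rho (v * w)%g x = rho v (rho w x).
Proof. by rewrite /rho gmulfM. Qed.

Lemma rho1 x : rho 1%g x = x.
Proof.
have : rho 1%g (rho 1%g x) = rho 1%g x by rewrite -rhoM mulg1.
exact: (can_inj (@bij_funK _ _)).
Qed.

Lemma rhoK w x : rho w^-1%g (rho w x) = x.
Proof. by rewrite -rhoM mulVg rho1. Qed.
Lemma rhoVK w x : rho w (rho w^-1%g x) = x.
Proof. by rewrite -rhoM mulgV rho1. Qed.

(** The sign character, with values in the permutations of two elements; it shows that
    multiplication by a generator always changes the length. *)
Lemma parity_subproof : exists f : {multiplicative W -> bij bool},
  forall s, f (gen s) = Bij negbK negbK.
Proof.
apply: (cox_univ WS) => s t k _; apply: bij_eq => x.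
by rewrite bij_funX; elim: k => //= k ->; rewrite negbK.
Qed.

Definition word := word_val gen.

Lemma word_nil : word [::] = 1%g. Proof. by rewrite /word /word_val big_nil. Qed.
Lemma word_cons s r : word (s :: r) = (gen s * word r)%g.
Proof. by rewrite /word /word_val big_cons. Qed.
Lemma word_cat r r' : word (r ++ r') = (word r * word r')%g.
Proof. by rewrite /word /word_val big_cat. Qed.
Lemma word_rcons s r : word (rcons r s) = (word r * gen s)%g.
Proof. by rewrite -cats1 word_cat word_cons word_nil mulg1. Qed.

Lemma word_rev r : word (rev r) = (word r)^-1%g.
Proof.
elim: r => [|s r IH]; first by rewrite /rev /= word_nil invg1.
by rewrite rev_cons word_rcons word_cons invgM genV IH.
Qed.

Lemma word_surj w : exists r, word r = w.
Proof.
have : generated (range gen) w by rewrite (cox_gen WS).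
elim/generated_ind: w / => [|x y [r <-] [r' <-]|x [r <-]|_ [s _ <-]].
- by exists [::]; rewrite word_nil.
- by exists (r ++ r'); rewrite word_cat.
- by exists (rev r); rewrite word_rev.
- by exists [:: s]; rewrite word_cons word_nil mulg1.
Qed.

Lemma coxeter_ind (P : W -> Prop) : P 1%g ->
  (forall s w, P w -> P (gen s * w)%g) -> forall w, P w.
Proof.
move=> P1 PS w; have [r <-] := word_surj w.
by elim: r => [|s r IH]; rewrite ?word_nil// word_cons; apply: PS.
Qed.

Lemma parity_word : exists sg : W -> bool, forall r, sg (word r) = odd (size r).
Proof.
have [f fE] := parity_subproof; exists (fun w => bij_fun (f w) false).
elim=> [|s r IH]; last by rewrite word_cons gmulfM bij_funM /= IH fE.
have f1 : f 1%g = 1%g.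
  by apply: (mulgI (f 1%g)); rewrite -gmulfM !mulg1.
by rewrite word_nil f1.
Qed.

Lemma rho_lin w k x y : rho w (k *: x + y) = k *: rho w x + rho w y.
Proof.
elim/coxeter_ind: w x y => [|s w IH] x y; first by rewrite !rho1.
by rewrite !rhoM IH !rho_gen refl_lin.
Qed.

Lemma rhoD w x y : rho w (x + y) = rho w x + rho w y.
Proof. by have := rho_lin w 1 x y; rewrite !scale1r. Qed.
Lemma rho0 w : rho w 0 = 0.
Proof. by apply: (addrI (rho w 0)); rewrite -rhoD !addr0. Qed.
Lemma rhoZ w k x : rho w (k *: x) = k *: rho w x.
Proof. by have := rho_lin w k x 0; rewrite rho0 !addr0. Qed.
Lemma rhoN w x : rho w (- x) = - rho w x.
Proof. by rewrite -scaleN1r rhoZ scaleN1r. Qed.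
Definition rhoE := (rhoD, rhoN, rhoZ, rho0).

Lemma fm_rho w x y : fm (rho w x) (rho w y) = fm x y.
Proof.
elim/coxeter_ind: w x y => [|s w IH] x y; first by rewrite !rho1.
by rewrite !rhoM !rho_gen fm_refl ?fm_root2.
Qed.

Local Notation len := (cox_length gen).

Lemma len_word w : exists2 r, word r = w & size r = len w.
Proof.
have Pw : exists n, `[< exists2 r, word r = w & size r = n >].
  by have [r rw] := word_surj w; exists (size r); apply/asboolP; exists r.
have [n /asboolP[r rw rn] min] := ex_minnP Pw.
have rred : reduced gen r.
  by move=> r' r'w; rewrite rn; apply: min; apply/asboolP; exists r'; rewrite // -rw.
have : ([set size r | r in [set r | word r = w /\ reduced gen r]] (len w))%classic.
  by apply: (@xgetPex _ 0%N); exists (size r), r.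
by case=> r0 [r0w _] <-; exists r0.
Qed.

Lemma len_le r : (len (word r) <= size r)%N.
Proof.
have : ([set size r0 | r0 in [set r0 | word r0 = word r /\ reduced gen r0]]
         (len (word r)))%classic.
  have [r1 r1w _] := len_word (word r).
  have Pw : exists n, `[< exists2 r0, word r0 = word r & size r0 = n >].
    by exists (size r); apply/asboolP; exists r.
  have [n /asboolP[r0 rw rn] min] := ex_minnP Pw.
  apply: (@xgetPex _ 0%N); exists (size r0), r0 => //; split=> // r' r'w.
  by rewrite rn; apply: min; apply/asboolP; exists r'; rewrite // -rw.
by case=> r0 [r0w +] <- => /(_ r); apply; rewrite -[LHS]r0w.
Qed.

Lemma len1 : len 1%g = 0%N.
Proof. by apply/eqP; rewrite -leqn0 -word_nil len_le. Qed.

Lemma len0 w : len w = 0%N -> w = 1%g.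
Proof.
by have [r <- <-] := len_word w; case: r => //; rewrite word_nil.
Qed.

Lemma len_mul v w : (len (v * w)%g <= len v + len w)%N.
Proof.
have [r <- <-] := len_word v; have [r' <- <-] := len_word w.
by rewrite -size_cat -word_cat len_le.
Qed.

Lemma len_gen_le s : (len (gen s) <= 1)%N.
Proof. by have := len_le [:: s]; rewrite word_cons word_nil mulg1. Qed.

Lemma len_mulgen w s :
  len (w * gen s)%g = (len w).+1 \/ len w = (len (w * gen s)%g).+1.
Proof.
have [sg sgE] := parity_word.
have h1 : (len (w * gen s)%g <= len w + 1)%N.
  by apply: leq_trans (len_mul _ _) _; rewrite leq_add2l len_gen_le.
have h2 : (len w <= len (w * gen s)%g + 1)%N.
  rewrite -{1}(mulgK (gen s) w) genV; apply: leq_trans (len_mul _ _) _.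
  by rewrite leq_add2l len_gen_le.
have [r rw rl] := len_word w; have [r' rw' rl'] := len_word (w * gen s)%g.
have : odd (size r') = ~~ odd (size r).
  by rewrite -!sgE rw' -rw -word_rcons !sgE size_rcons.
by rewrite rl rl'; lia.
Qed.

Lemma len_descent w : w <> 1%g -> exists t, (len (w * gen t)%g < len w)%N.
Proof.
have [r <- rl] := len_word w; elim/last_ind: r rl => [|r t _] rl.
  by rewrite word_nil.
exists t; rewrite -rl word_rcons -mulgA gen_sq mulg1 size_rcons ltnS.
exact: len_le.
Qed.

End CoxeterSystem.

Arguments rho : simpl never.

(** * Positive roots *)

Ltac lenlia :=
  clear; repeat match goal with
    |- context [cox_length ?g ?w] => move: (cox_length g w) => ? end; lia.

Section PositiveRoots.
Variables (R : realType) (S : Type) (m : S -> S -> option nat).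
Variables (W : groupType) (gen : S -> W).
Hypothesis WS : coxeter_system m gen.

Local Notation space := (free R {classic (S + S)}).
Local Notation root := (root R).
Local Notation fm := (bform (R := R) m).
Local Notation rho := (rho (R := R) WS).
Local Notation len := (cox_length gen).
Let m_sym := cox_sym WS.
Let m_pos := cox_pos WS.
Let m_diag := cox_diag WS.

Definition pos (x : space) : Prop := forall a, 0 <= coord x a.

Lemma pos_root s : pos (root s).
Proof. by move=> a; rewrite coord_bas ler0n. Qed.

Lemma pos_comb k l x y : 0 <= k -> 0 <= l -> pos x -> pos y ->
  pos (k *: x + l *: y).
Proof.
move=> k0 l0 x0 y0 a; rewrite /coord evD !evZ.
by rewrite addr_ge0 ?mulr_ge0 ?x0 ?y0.
Qed.

Fixpoint altw (s t : S) (j : nat) : W :=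
  if j is i.+1 then (gen (letter s t i) * altw s t i)%g else 1%g.

Lemma altw_rho s t j x : rho (altw s t j) x = altrefl m s t j x.
Proof.
by elim: j => [|j IH] /=; rewrite ?rho1// rhoM IH rho_gen.
Qed.

Lemma altwSr s t j : altw s t j.+1 = (altw t s j * gen t)%g.
Proof.
elim: j => [|j IH]; first by rewrite /= /letter /= mulg1 mul1g.
rewrite [LHS]/= -/(altw s t j.+1) IH /= mulgA; congr (_ * _ * _)%g.
by rewrite /letter /=; case: (odd j).
Qed.

Lemma altw_double s t i : altw s t i.*2 = ((gen s * gen t) ^+ i)%g.
Proof.
elim: i => [|i IH] //; rewrite doubleS /= IH expgS /letter /= odd_double /=.
by rewrite mulgA.
Qed.

Lemma altw_braid s t k : m s t = Some k -> altw s t k = altw t s k.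
Proof.
move=> /(cox_rel WS) st; set a := (gen s * gen t)%g in st.
have aV : (gen t * gen s = a^-1)%g by rewrite invgM !(genV WS).
have := odd_double_half k; case: (odd k) => /= kE; last first.
  rewrite -kE add0n !altw_double -/a aV expVgn; apply/esym/mulg1_eq.
  by rewrite -expgnDr addnn -[_.*2]add0n kE.
rewrite -kE add1n [altw s t _]/= [altw t s _]/= !altw_double /letter odd_double.
rewrite -/a aV expVgn -[LHS]mul1g -(gen_sq WS s) -!mulgA; congr (_ * _)%g.
apply/esym/mulg1_eq; rewrite (mulgA (gen s)) -/a -expgS -expgnDr -[RHS]st -kE.
by congr (_ ^+ _)%g; rewrite -addnn; lia.
Qed.

Lemma len_altw s t j : (len (altw s t j) <= j)%N.
Proof.
elim: j => [|j IH] /=; first by rewrite (len1 WS).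
apply: leq_trans (len_mul WS _ _) _.
by rewrite -add1n leq_add// (len_gen_le WS).
Qed.

(** Induction on the length. For a descent [t] of [w], strip from the right of [w] the longest
    alternating word in [s] and [t], ending in [t], whose removal lowers the length by its full
    size. The rest ascends at both [s] and [t], so the induction hypothesis applies to it, and
    [altrefl_root] writes [rho w (root s)] through the two positive roots so obtained. *)
Lemma len_ascent_pos w s : (len w < len (w * gen s)%g)%N -> pos (rho w (root s)).
Proof.
have [n] := ubnP (len w); elim: n w s => // n IH w s; rewrite ltnS => wn ws.
have [->|w1] := pselect (w = 1%g); first by rewrite rho1; apply: pos_root.
have [t wt] := len_descent WS w1.
have st : s <> t by move=> st; move: ws; rewrite st => /(ltn_trans wt); rewrite ltnn.
pose v j := (w * (altw s t j)^-1)%g.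
have vw j : w = (v j * altw s t j)%g by rewrite /v mulgVK.
have vS j : v j = (v j.+1 * gen (letter s t j))%g.
  by rewrite /v /= invgM mulgA mulgVK.
have vS' j : v j.+1 = (v j * gen (letter s t j))%g.
  by rewrite /v /= invgM (genV WS) mulgA.
pose P j := (j <= len w)%N && (len (v j) + j == len w)%N.
have P1 : P 1%N.
  rewrite /P /v /= mulg1 (genV WS) /letter /=.
  by have := len_mulgen WS w t; move: wt; lenlia.
have Pbound j : P j -> (j <= len w)%N by case/andP.
have exP : exists j, P j by exists 1%N.
have [[|i] Pj jmax] := ex_maxnP exP Pbound; first by have := jmax _ P1.
set j := i.+1 in Pj jmax; have [jw /eqP vj] := andP Pj.
have ay : (len (v j) < len (v j * gen (letter s t j))%g)%N.
  have := jmax j.+1; have := len_mulgen WS (v j) (letter s t j).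
  by rewrite -vS' /P; move: jw vj; rewrite /j; lenlia.
have ax : (len (v j) < len (v j * gen (letter s t i))%g)%N.
  have := len_mul WS (v i) (altw s t i); rewrite -vw -vS.
  have := len_mulgen WS (v j) (letter s t i); rewrite -vS.
  by move: (len_altw s t i) vj; rewrite /j; lenlia.
have vn : (len (v j) < n)%N by move: vj wn; rewrite /j; lenlia.
have py := IH _ _ vn ay; have px := IH _ _ vn ax.
rewrite (vw j) rhoM altw_rho altrefl_root// rhoD !rhoZ.
(* An alternating suffix of length [m s t] could be rewritten by the braid relation so as to end in
   [s], against the ascent at [s]. The bound makes the Chebyshev coefficients nonnegative. *)
have jm : if m s t is Some k then (j < k)%N else true.
  case mst : (m s t) => [k|] //; rewrite ltnNge; apply/negP => kj.
  have lenv : (len (v k) + k <= len w)%N.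
    rewrite -vj; have -> : (j = k + (j - k))%N by lia.
    elim: (j - k)%N => [|d IHd]; first by rewrite addn0.
    have := len_mul WS (v (k + d).+1) (gen (letter s t (k + d))).
    rewrite -vS addnS; move: IHd (len_gen_le WS (letter s t (k + d))); lenlia.
  have k0 : k <> 0%N by move=> k0; apply: (m_pos (s := s) (t := t)); rewrite mst k0.
  case: k k0 mst kj lenv => // k _ mst kj lenv.
  have wsE : (w * gen s = v k.+1 * altw t s k.+1 * gen s)%g.
    by rewrite {1}(vw k.+1) (altw_braid mst).
  rewrite altwSr mulgA -[(_ * gen s * gen s)%g]mulgA (gen_sq WS) mulg1 in wsE.
  have := len_mul WS (v k.+1) (altw s t k); rewrite -wsE.
  by move: (len_altw s t k) ws lenv; lenlia.
have m0 : m s t <> Some 0%N by apply: m_pos.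
have m1 : m s t <> Some 1%N by move=> /m_diag.
apply: pos_comb => //.
- by apply: (@cheb_mcoef_ge0 R (m s t) j.+1 m0 m1); case: (m s t) jm.
- by apply: (@cheb_mcoef_ge0 R (m s t) j m0 m1); case: (m s t) jm => // k /ltnW.
by move: px; rewrite /j /letter /= negbK.
Qed.

Lemma len_descent_neg w s : (len (w * gen s)%g < len w)%N ->
  pos (- rho w (root s)).
Proof.
move=> ws; rewrite -rhoN -(refl_root (fm_root2 R m_diag s)) -(rho_gen WS) -rhoM.
by apply: len_ascent_pos; rewrite -mulgA (gen_sq WS) mulg1.
Qed.

Lemma pos_dichotomy w s : pos (rho w (root s)) \/ pos (- rho w (root s)).
Proof.
have [ws|ws] := len_mulgen WS w s; [left; apply: len_ascent_pos|
  right; apply: len_descent_neg]; by move: ws; lenlia.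
Qed.

Lemma pos_eq0 x : pos x -> pos (- x) -> x = 0.
Proof.
move=> x0 nx0; apply: coord_eq0 => a; apply/eqP; rewrite eq_le x0 andbT.
by rewrite -oppr_ge0; have := nx0 a; rewrite coordN.
Qed.

Lemma root_neq0 (s : S) : root s <> 0.
Proof.
move=> s0; have := fm_root2 R m_diag s; rewrite s0 fm0l => /eqP.
by rewrite eq_sym pnatr_eq0.
Qed.

Lemma rho_inj w : injective (rho w).
Proof. exact: can_inj (rhoK WS w). Qed.

Lemma rho_eq0 w x : rho w x = 0 -> x = 0.
Proof. by move=> wx; apply: (@rho_inj w); rewrite wx rho0. Qed.

Lemma pos_rootP w s : (len w < len (w * gen s)%g)%N <-> pos (rho w (root s)).
Proof.
split; first exact: len_ascent_pos.
move=> ps; have [ws|ws] := len_mulgen WS w s; first by move: ws; lenlia.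
have ns : pos (- rho w (root s)) by apply: len_descent_neg; move: ws; lenlia.
by have /rho_eq0/root_neq0 := pos_eq0 ps ns.
Qed.

Lemma neg_rootP w s : (len (w * gen s)%g < len w)%N <-> pos (- rho w (root s)).
Proof.
split; first exact: len_descent_neg.
move=> ns; have [ws|ws] := len_mulgen WS w s; last by move: ws; lenlia.
have ps : pos (rho w (root s)) by apply: len_ascent_pos; move: ws; lenlia.
by have /rho_eq0/root_neq0 := pos_eq0 ps ns.
Qed.

Lemma rho_pos_eq1 w : (forall s, pos (rho w (root s))) -> w = 1%g.
Proof.
move=> wp; apply: contrapT => w1.
have [t /neg_rootP nt] := len_descent WS w1.
by have /rho_eq0/root_neq0 := pos_eq0 (wp t) nt.
Qed.

Lemma rho_faithful v w : (forall s, rho v (root s) = rho w (root s)) -> v = w.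
Proof.
move=> vw; apply: (mulgI w^-1%g); rewrite mulVg; apply: rho_pos_eq1 => s.
by rewrite rhoM vw rhoK; apply: pos_root.
Qed.

(** The span of the simple roots, recognised by the vanishing of the coordinates at the added dual
    vectors. *)
Definition span (x : space) : Prop :=
  forall s, coord x (inr s : {classic (S + S)}) = 0.

Lemma span_root s : span (root s).
Proof. by move=> t; rewrite coord_bas; case: eqP. Qed.

Lemma spanD x y : span x -> span y -> span (x + y).
Proof. by move=> xs ys s; rewrite coordD xs ys addr0. Qed.
Lemma spanZ k x : span x -> span (k *: x).
Proof. by move=> xs s; rewrite coordZ xs mulr0. Qed.
Lemma spanN x : span x -> span (- x).
Proof. by move=> xs; rewrite -scaleN1r; apply: spanZ. Qed.

Lemma span_rho w x : span x -> span (rho w x).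
Proof.
elim/(coxeter_ind WS): w x => [|s w IH] x xs; first by rewrite rho1.
rewrite rhoM rho_gen /reflection; apply: spanD; first exact: IH.
exact/spanN/spanZ/span_root.
Qed.

Lemma ev_fm x y : ev x (fun a => fm (bas R a) y) = fm x y.
Proof. by []. Qed.

Lemma span_fm_le0 x y : span x -> pos x ->
  (forall s, fm (root s) y <= 0) -> fm x y <= 0.
Proof.
move=> xs xp ys; rewrite -ev_fm -oppr_ge0 -ev_oppr.
apply: ev_ge0 => -[] s; first by rewrite mulr_ge0 ?oppr_ge0// ys.
by rewrite (xs s) mul0r.
Qed.

Lemma span_ind (P : space -> Prop) : P 0 ->
  (forall k s y, span y -> P y -> P (k *: root s + y)) ->
  forall x, span x -> P x.
Proof.
move=> P0 PS x xs; have [l ul [c xE]] := free_seq x.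
have c0 s : (inr s : {classic (S + S)}) \in l ->
    c (inr s : {classic (S + S)}) = 0.
  move=> sl; rewrite -(xs s) /coord xE (bigD1_seq _ sl ul)/= eqxx mulr1.
  by rewrite big1 ?addr0// => b /negPf ->; rewrite mulr0.
have -> : x = \sum_(a <- l) c a *: bas R a.
  apply/free_eq => g; rewrite xE.
  by elim/big_rec2: _ => [|a y1 y2 _ ->]; rewrite ?ev0// evD evZ.
suff [] : span (\sum_(a <- l) c a *: bas R a) /\ P (\sum_(a <- l) c a *: bas R a).
  by [].
elim: l {ul xE} c0 => [|a l IH] c0; first by rewrite big_nil.
have [|sy Py] := IH; first by move=> s sl; apply: c0; rewrite inE sl orbT.
rewrite big_cons; case: a c0 => s c0.
  by split; [apply: spanD => //; apply/spanZ/span_root|apply: PS].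
by rewrite c0 ?inE ?eqxx// scale0r add0r.
Qed.

Lemma span_scale k w x : span x ->
  (forall s, rho w (root s) = k *: root s) -> rho w x = k *: x.
Proof.
move=> xs kw; elim/span_ind: xs => [|l s y _ IH]; first by rewrite rho0 scaler0.
by rewrite rho_lin kw IH; vring.
Qed.

(** The equivalence of [P u] and [P (u * v)] for all [u] is stable under products and inverses in
    [v], whereas [P] is only known to pass to products with one generator on the right. *)
Lemma parabolic_ind (I : set S) (P : W -> Prop) : P 1%g ->
  (forall v s, parabolic gen I v -> I s -> P v -> P (v * gen s)%g) ->
  forall v, parabolic gen I v -> P v.
Proof.
move=> P1 PS v Iv; have [G1 GM GV] := generated_subgroup [set gen x | x in I]%classic.
suff [_ h] : parabolic gen I v /\
    forall u, parabolic gen I u -> P u <-> P (u * v)%g.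
  by rewrite -[v]mul1g -h.
elim/generated_ind: v / Iv => [|x y [Ix IHx] [Iy IHy]|x [Ix IHx]|_ [s Is <-]].
- by split=> // u _; rewrite mulg1.
- split=> [|u Iu]; first exact: GM.
  by rewrite mulgA -IHy -?IHx//; apply: GM.
- split=> [|u Iu]; first exact: GV.
  have := IHx (u * x^-1)%g; rewrite mulgVK => h.
  by apply: iff_sym; apply: h; apply: GM => //; apply: GV.
- have Igs : parabolic gen I (gen s) by apply: sub_generated; exists s.
  split=> // u Iu; split=> [Pu|Pus]; first exact: PS.
  by rewrite -[u]mulg1 -(gen_sq WS s) mulgA; apply: PS => //; apply: GM.
Qed.

(** On the roots of [I], [z * v] acts as minus [v], so a generator shortens [z * v] exactly when it
    lengthens [v]. The lengths of [z * v] and [v] therefore add up to that of [z], which makes [z]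
    longest and unique. *)
Lemma longest_eltE (I : set S) z : parabolic gen I z ->
  (forall s, I s -> rho z (root s) = - root s) -> longest_elt gen I = z.
Proof.
move=> Iz zI.
have zI2 v s : parabolic gen I v -> I s -> rho (z * v)%g (root s) = - rho v (root s).
  move=> Iv; elim/parabolic_ind: v / Iv s => [s Is|v t Iv It IH s Is].
    by rewrite mulg1 rho1 zI.
  rewrite mulgA !(rhoM _ _ (gen t)) !rho_gen /reflection !rhoE IH// (IH t)//.
  by vring.
have lz v : parabolic gen I v -> (len (z * v)%g + len v = len z)%N.
  elim/parabolic_ind => [|u s Iu Is IH]; first by rewrite mulg1 (len1 WS) addn0.
  have zvs := zI2 _ _ Iu Is; rewrite mulgA.
  have [vs|vs] := len_mulgen WS u s.
    have /pos_rootP pv : (len u < len (u * gen s)%g)%N by rewrite vs.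
    have /neg_rootP : pos (- rho (z * u)%g (root s)) by rewrite zvs opprK.
    by have := len_mulgen WS (z * u)%g s; move: vs IH; lenlia.
  have /neg_rootP pv : (len (u * gen s)%g < len u)%N by rewrite vs.
  have /pos_rootP : pos (rho (z * u)%g (root s)) by rewrite zvs.
  by have := len_mulgen WS (z * u)%g s; move: vs IH; lenlia.
have lz' v : parabolic gen I v -> (len v <= len z)%N.
  by move=> /lz <-; rewrite leq_addl.
have zz : (z * z = 1)%g.
  by apply: (len0 WS); have := lz z Iz; lenlia.
rewrite /longest_elt; case: xgetP => [w _ [Iw wmax]|]; last first.
  by move=> /(_ z)[]; split.
have : len (z * w)%g = 0%N.
  by have := lz w Iw; have := lz' w Iw; have := wmax z Iz; lenlia.
move=> /(len0 WS) zw; apply: (mulgI z); by rewrite zw zz.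
Qed.

End PositiveRoots.

(** * Simultaneous eigenvectors of a normal subgroup *)

Section NormalSubgroups.
Variables (R : realType) (S : Type) (m : S -> S -> option nat).
Variables (W : groupType) (gen : S -> W).
Hypothesis WS : coxeter_system m gen.

Local Notation space := (free R {classic (S + S)}).
Local Notation root := (root R).
Local Notation fm := (bform (R := R) m).
Local Notation refl := (reflection (R := R) m).
Local Notation rho := (rho (R := R) WS).
Let m_sym := cox_sym WS.
Let m_pos := cox_pos WS.
Let m_diag := cox_diag WS.
Let fmE := fmE R m_sym.

Definition isroot (b : space) := exists w s, b = rho w (root s).

Lemma isroot_simple s : isroot (root s).
Proof. by exists 1%g, s; rewrite rho1. Qed.

Lemma isroot_rho w b : isroot b -> isroot (rho w b).
Proof. by move=> [v [s ->]]; exists (w * v)%g, s; rewrite rhoM. Qed.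

Lemma isrootN b : isroot b -> isroot (- b).
Proof.
move=> [v [s ->]]; exists (v * gen s)%g, s.
by rewrite rhoM rho_gen refl_root ?fm_root2// rhoN.
Qed.

Lemma isroot2 b : isroot b -> fm b b = 2.
Proof. by move=> [w [s ->]]; rewrite fm_rho fm_root2. Qed.

Lemma isroot_neq0 b : isroot b -> b <> 0.
Proof. by move=> /isroot2 + b0; rewrite b0 fm0l => /eqP; rewrite eq_sym pnatr_eq0. Qed.

Lemma isroot_span b : isroot b -> span b.
Proof. by move=> [w [s ->]]; apply/span_rho/span_root. Qed.

Lemma isroot_refl b : isroot b -> exists r, forall x, rho r x = refl b x.
Proof.
move=> [w [s ->]]; exists (w * gen s * w^-1)%g => x.
rewrite !rhoM rho_gen /reflection !rhoE rhoVK; congr (_ - _ *: _).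
by rewrite -(fm_rho (R := R) WS w (rho w^-1%g x)) rhoVK.
Qed.

Lemma isroot_pos b : isroot b -> pos b \/ pos (- b).
Proof. by move=> [w [s ->]]; apply: pos_dichotomy. Qed.

Lemma commute_root_image k t r b : isroot b -> (forall x, rho r x = refl b x) ->
  (t * t = 1)%g -> commute k t -> commute k (r * t * r)%g ->
  rho t b <> b -> rho t b <> - b ->
  [\/ rho k b = b, rho k b = - b, rho k b = rho t b | rho k b = - rho t b].
Proof.
move=> br rE tt kt krtr tb tNb; set g := rho t b in tb tNb *.
have bb := isroot2 br.
have gg : fm g g = 2 by rewrite fm_rho.
have gr : isroot g by apply: isroot_rho.
have ttx x : rho t (rho t x) = x by rewrite -rhoM tt rho1.
have tg : rho t g = b by rewrite ttx.
pose p := (t * (r * t * r))%g.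
have pE x : rho p x = refl g (refl b x).
  rewrite /p !rhoM !rE; move: (refl b x) => y.
  rewrite /reflection rhoD rhoN rhoZ ttx -/g; congr (_ - _ *: _).
  by rewrite -(fm_rho (R := R) WS t) ttx.
have kp x : rho k (rho p x) = rho p (rho k x).
  rewrite -!rhoM; congr (rho _ x); exact: commuteM.
(* If there is no such vector, nondegeneracy makes [g] a multiple of [b], and the norms make the
   factor 1 or -1. *)
have [v vb vg] : exists2 v, fm v b = 0 & fm v g <> 0.
  apply: contrapT => nv.
  have gb : g = (fm b g / 2) *: b.
    apply: (fm_inj m_sym) => v; rewrite fmE (fmC m_sym g) (fmC m_sym b v).
    have : fm (v - (fm v b / 2) *: b) g = 0.
      apply: contrapT => h; apply: nv; exists (v - (fm v b / 2) *: b) => //.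
      by rewrite !fmE bb divfK ?pnatr_eq0// subrr.
    by rewrite !fmE => h; lra.
  have := gg; rewrite gb !fmE bb; set c := fm b g / 2 in gb *.
  move=> c2; have : (c - 1) * (c + 1) = 0 by lra.
  move=> /eqP; rewrite mulf_eq0 subr_eq0 addr_eq0 => /orP[] /eqP cE.
    by apply: tb; rewrite gb cE scale1r.
  by apply: tNb; rewrite gb cE scaleN1r.
(* Since [p] shifts [v] by a multiple of [g] alone, applying [k] expresses [rho k g] through the
   shift of [rho k v], which lies in the plane of [b] and [g]. *)
have [P [Q kg]] : exists P Q, rho k g = P *: b + Q *: g.
  pose d := fm v g; pose u := rho k v.
  exists (fm u b / d), ((fm u g - fm u b * fm b g) / d).
  have pv : rho p v = v - d *: g by rewrite pE /reflection vb scale0r subr0.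
  have : rho k (rho p v) = rho p u by rewrite kp.
  rewrite pv !rhoE -/u pE /reflection !fmE => h.
  have /eqP d0 : d <> 0 by [].
  have -> : rho k g = d^-1 *: (u - (u - d *: rho k g)).
    rewrite opprB addrC subrK scalerA mulVf// scale1r //.
  by rewrite h; vring.
have kb : rho k b = P *: g + Q *: b.
  by rewrite -tg -rhoM kt rhoM kg !rhoE tg -/g.
have pb : rho p b = fm b g *: g - b.
  by rewrite pE (refl_root bb) /reflection !fmE; vring.
have pg : rho p g = (fm b g ^+ 2 - 1) *: g - fm b g *: b.
  by rewrite pE /reflection !fmE gg (fmC m_sym g b); vring.
set c := fm b g in pb pg.
have := kp b; rewrite pb kb !rhoE kg kb pb pg => h.
(* The two sides of [h] differ by [c * P] times [c *: g - 2 *: b], whose vanishing would again make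
   [g] equal to [b] or [- b]. *)
have cP : c * P = 0.
  apply/eqP/negPn/negP => cP0; have c0 : c != 0.
    by apply: contra cP0 => /eqP ->; rewrite mul0r.
  have gb : c *: g = 2 *: b.
    apply: (scalerI cP0); apply/eqP; rewrite -subr_eq0; apply/eqP.
    transitivity (P *: ((c ^+ 2 - 1) *: g - c *: b) + Q *: (c *: g - b) -
      (c *: (P *: b + Q *: g) - (P *: g + Q *: b))); first by vring.
    by rewrite -h subrr.
  have : fm (c *: g) g = fm (2 *: b) g by rewrite gb.
  have : fm (c *: g) (c *: g) = fm (2 *: b) (2 *: b) by rewrite gb.
  rewrite !fmE gg bb -/c => c4 _; have : (c - 2) * (c + 2) = 0 by lra.
  move=> /eqP; rewrite mulf_eq0 subr_eq0 addr_eq0 => /orP[] /eqP cE.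
    by apply: tb; apply: (scalerI c0); rewrite gb cE.
  by apply: tNb; apply: (scalerI c0); rewrite gb cE; vring.
(* Invariance of the form now leaves one of [P], [Q] equal to zero and the other a sign. *)
have n1 : fm (rho k b) (rho k b) = 2 by rewrite fm_rho.
have n2 : fm (rho k b) (rho k g) = c by rewrite fm_rho.
move: n1 n2; rewrite kb kg !fmE bb gg (fmC m_sym g b) -/c => n1 n2.
have PQ1 : P ^+ 2 + Q ^+ 2 = 1.
  have : 2 * (P ^+ 2 + Q ^+ 2) + 2 * Q * (c * P) = 2 by rewrite -[RHS]n1; ring.
  by rewrite cP => ?; lra.
have PQ0 : P * Q = 0.
  have : 4 * (P * Q) + c * (P ^+ 2 + Q ^+ 2) = c by rewrite -[RHS]n2; ring.
  by rewrite PQ1 => ?; lra.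
have sq1 (z : R) : z ^+ 2 = 1 -> z = 1 \/ z = -1.
  move=> z2; have : (z - 1) * (z + 1) = 0 by rewrite -subr_sqr_1 z2 subrr.
  by move=> /eqP; rewrite mulf_eq0 subr_eq0 addr_eq0 => /orP[]/eqP; [left|right].
move/eqP: PQ0; rewrite mulf_eq0 => /orP[] /eqP z0; rewrite z0 in PQ1 *.
  have /sq1[->|->] : Q ^+ 2 = 1 by rewrite -PQ1; ring.
    by constructor 1; vring.
  by constructor 2; vring.
have /sq1[->|->] : P ^+ 2 = 1 by rewrite -PQ1; ring.
  by constructor 3; vring.
by constructor 4; vring.
Qed.

Variable H : set W.
Hypothesis nH : normal_subgroup H.

Let HV x : H x -> H x^-1%g. Proof. by have [[_ _ h] _] := nH; apply: h. Qed.
Let HJ x w : H x -> H (w^-1 * x * w)%g.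
Proof. by have [_ h] := nH => /(h _ w); rewrite /conjg mulgA. Qed.
Let HJV x w : H x -> H (w * x * w^-1)%g.
Proof. by move=> /(HJ w^-1%g); rewrite invgK. Qed.

Definition eigen (x : space) := forall h, H h -> rho h x = x \/ rho h x = - x.

Lemma eigen_rho w x : eigen x -> eigen (rho w x).
Proof.
move=> ex h Hh; have [hw|hw] := ex _ (HJ w Hh); [left|right].
  by rewrite -[in RHS]hw !rhoM rhoVK.
by rewrite -rhoN -hw !rhoM rhoVK.
Qed.

Lemma eigenZ k x : eigen x -> eigen (k *: x).
Proof.
by move=> ex h Hh; rewrite rhoZ; have [->|->] := ex h Hh; [left|right; rewrite scalerN].
Qed.

Lemma eigenN x : eigen x -> eigen (- x).
Proof. by move=> /(eigenZ (-1)); rewrite scaleN1r. Qed.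

(** The element [t] shows that [H] acts on the two parts through different sign characters;
    orthogonality of the parts comes from it. *)
Definition splits (d x y : space) :=
  [/\ d = x + y, eigen x, eigen y &
    exists2 t, H t & [/\ rho t x = - x, rho t y = y, x <> 0 & y <> 0]].

Definition diagonalizable :=
  forall d, isroot d -> eigen d \/ exists x y, splits d x y.

Lemma half_splits d t : H t -> rho t (rho t d) = d -> rho t d <> d -> rho t d <> - d ->
  eigen (d - rho t d) -> eigen (d + rho t d) ->
  splits d (2^-1 *: (d - rho t d)) (2^-1 *: (d + rho t d)).
Proof.
move=> Ht tt td tNd e1 e2; have n2 : (2 : R)^-1 != 0 by rewrite invr_eq0 pnatr_eq0.
split; [|exact: eigenZ|exact: eigenZ|].
  by apply: free_eq => g; rewrite !evE; field.
exists t => //; split; rewrite ?rhoE ?tt.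
- by vring.
- by rewrite addrC.
- by move=> /eqP; rewrite scaler_eq0 (negPf n2) subr_eq0 => /eqP/esym.
- move=> /eqP; rewrite scaler_eq0 (negPf n2) addr_eq0 => /eqP dt.
  by apply: tNd; rewrite [in RHS]dt opprK.
Qed.

Hypothesis irr : irreducible m.

Lemma adjacent_neq0 s t : cox_edge m s t -> fm (root s) (root t) != 0.
Proof.
rewrite /cox_edge fm_root oppr_eq0; move: (m s t) => k k3; apply/eqP => c0.
have k0 : k <> Some 0%N by move=> e; rewrite e in k3.
have k1 : k <> Some 1%N by move=> e; rewrite e in k3.
by move: k3; rewrite (mcoef_eq k0 k1 (n := 2) _ (etrans c0 (esym (mcoef2 R)))).
Qed.

(* Adjacent simple roots are not orthogonal, so each is a combination of the
   other and of its reflection. *)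
Lemma orbit_ind (P : space -> Prop) b :
  (forall k x y, P x -> P y -> P (k *: x + y)) ->
  isroot b -> (forall w, P (rho w b)) -> forall d, isroot d -> P d.
Proof.
move=> Plin [v [s ->]] Pb d [w [t ->]]; move: w.
have {Pb} : forall w, P (rho w (root s)).
  by move=> u; have := Pb (u * v^-1)%g; rewrite -rhoM mulgVK.
elim: (irr s t) => [{}s {}t st Ps w|//|{}s u {}t _ IH1 _ IH2 Ps].
  have c0 := adjacent_neq0 st; set c := fm _ _ in c0.
  have P0 : P 0 by have := Plin (-1) _ _ (Ps w) (Ps w); rewrite scaleN1r addNr.
  suff -> : rho w (root t) = c^-1 *: (-1 *: rho (w * gen t)%g (root s) + rho w (root s)) + 0.
    exact/Plin/P0/Plin/Ps/Ps.
  rewrite rhoM rho_gen /reflection rhoD rhoN rhoZ -/c.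
  by apply: free_eq => g; rewrite !evE; field.
exact/IH2/IH1.
Qed.

Lemma eigen_rootN h b : H h -> eigen b -> forall w, rho (h * h)%g (rho w b) = rho w b.
Proof.
by move=> Hh eb w; rewrite rhoM; have [hb|hb] := eigen_rho w eb Hh; rewrite !hb// rhoN hb opprK.
Qed.

(** The reflection in any root [c] of the orbit of [b] commutes with [H], so [commute_root_image]
    applies to it and shows that a multiple of [c] is [d - rho t d] or [d + rho t d]. The mirror
    image of [c] under the reflection in [d] gives the other one: if both gave the same, [d] would
    be proportional to [c] and hence an eigenvector. *)
Lemma eigen_root_diagonalizable b : isroot b -> eigen b -> diagonalizable.
Proof.
move=> br eb d dr; have [ed|ned] := pselect (eigen d); first by left.
right; have [t Ht [td tNd]] : exists2 t, H t & rho t d <> d /\ rho t d <> - d.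
  apply: contrapT => nt; apply: ned => h Hh; apply: contrapT => hd.
  by apply: nt; exists h => //; split=> e; apply: hd; [left|right].
(* Elements of [H] act by signs on the orbit of [b], and this orbit spans all roots. *)
have tt : (t * t = 1)%g.
  apply: (rho_faithful (R := R) (WS := WS)) => s; rewrite rho1.
  apply: (orbit_ind (P := fun x => rho (t * t)%g x = x) _ br (eigen_rootN Ht eb)
    (isroot_simple s)) => k x y xs ys.
  by rewrite rho_lin xs ys.
have [w wd] : exists w, fm (rho w b) d <> 0.
  apply: contrapT => nw.
  have : fm d d = 0.
    apply: (orbit_ind (P := fun x => fm x d = 0) _ br _ dr) => [k x y xd yd|w].
      by rewrite !fmE xd yd mulr0 addr0.
    by apply: contrapT => h; apply: nw; exists w.
  by rewrite (isroot2 dr) => /eqP; rewrite pnatr_eq0.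
have [r rE] := isroot_refl dr.
have tdE a x : a *: d = x -> eigen x -> a != 0 -> False.
  move=> ad /(_ t Ht) tx a0; have : rho t (a *: d) = a *: d \/ rho t (a *: d) = - (a *: d).
    by rewrite ad.
  by rewrite rhoZ -scalerN => -[] /(scalerI a0); [exact: td|exact: tNd].
have key c : isroot c -> eigen c -> fm d c <> 0 ->
    fm d c *: c = d - rho t d \/ fm d c *: c = d + rho t d.
  move=> cr ec dc; have [k kE] := isroot_refl cr.
  have kcomm h : H h -> commute k h.
    move=> Hh; apply: (rho_faithful (R := R) (WS := WS)) => s.
    rewrite !rhoM !kE /reflection -[fm (root s) c](fm_rho WS h) rhoD rhoN rhoZ.
    by have [->|->] := ec h Hh; rewrite ?fmE; vring.
  have Hrtr : H (r * t * r)%g.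
    suff {2}-> : r = r^-1%g by apply: HJV.
    apply/esym/mulg1_eq/(rho_faithful (R := R) (WS := WS)) => s.
    by rewrite rhoM !rE reflK ?isroot2// rho1.
  have := commute_root_image dr rE tt (kcomm t Ht) (kcomm _ Hrtr) td tNd.
  have dcN : fm d c *: c <> 0.
    by move=> /eqP; rewrite scaler_eq0 => /orP[]/eqP // /(isroot_neq0 cr).
  rewrite kE /reflection => h.
  have qE : fm d c *: c = d - (d - fm d c *: c) by vring.
  case: h => e; rewrite e in qE.
  - by case: dcN; rewrite qE subrr.
  - by case: (tdE 2 (fm d c *: c)); rewrite ?pnatr_eq0 ?qE//; [vring|rewrite -qE; exact: eigenZ].
  - by left.
  - by right; rewrite qE opprK.
have dc : fm d (rho w b) <> 0 by rewrite (fmC m_sym).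
have cr : isroot (rho w b) by apply: isroot_rho.
have ec : eigen (rho w b) by apply: eigen_rho.
have crc : isroot (refl d (rho w b)) by rewrite -rE; apply: isroot_rho.
have erc : eigen (refl d (rho w b)) by rewrite -rE; apply: eigen_rho.
have drc : fm d (refl d (rho w b)) = - fm d (rho w b).
  by rewrite /reflection !fmE (isroot2 dr) (fmC m_sym d); ring.
have drc0 : fm d (refl d (rho w b)) <> 0 by rewrite drc => /eqP; rewrite oppr_eq0 => /eqP.
have k1 := key _ cr ec dc; have k2 := key _ crc erc drc0.
set q := fm d (rho w b) in dc k1 drc; set c := rho w b in k1 k2 ec crc drc.
have e1 := eigenZ q ec; have e2 := eigenZ (fm d (refl d c)) erc.
have q2 : fm d (refl d c) *: refl d c = q ^+ 2 *: d - q *: c.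
  by rewrite drc /reflection (fmC m_sym c) -/q; vring.
have q2N : q *: c = fm d (refl d c) *: refl d c -> False.
  move=> h; apply: (tdE (q ^+ 2) ((2 * q) *: c)); last by rewrite sqrf_eq0; apply/eqP.
    by rewrite -[LHS](subrK (q *: c)) -q2 -h; vring.
  exact: eigenZ.
have tt' : rho t (rho t d) = d by rewrite -rhoM tt rho1.
exists (2^-1 *: (d - rho t d)), (2^-1 *: (d + rho t d)).
case: k1 k2 => k1 [] k2.
- by case: q2N; rewrite k1 k2.
- by apply: half_splits => //; rewrite -?k1 -?k2.
- by apply: half_splits => //; rewrite -?k1 -?k2.
- by case: q2N; rewrite k1 k2.
Qed.

Definition sgn1 (e : R) := e = 1 \/ e = -1.

Lemma sgn1M e f : sgn1 e -> sgn1 f -> sgn1 (e * f).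
Proof. by move=> [] -> [] ->; rewrite ?mul1r ?mulN1r ?opprK; [left|right|right|left]. Qed.

Lemma sgn1_sq e : sgn1 e -> e * e = 1.
Proof. by move=> [] ->; rewrite ?mul1r ?mulN1r ?opprK. Qed.

Lemma sgn1E w x : rho w x = x \/ rho w x = - x <-> exists2 e, sgn1 e & rho w x = e *: x.
Proof.
split=> [[->|->]|[e [] -> ->]].
- by exists 1; rewrite ?scale1r//; left.
- by exists (-1); rewrite ?scaleN1r//; right.
- by left; rewrite scale1r.
- by right; rewrite scaleN1r.
Qed.

Lemma eigen_generated A x : H = generated A ->
  (forall u, A u -> rho u x = x \/ rho u x = - x) -> eigen x.
Proof.
move=> HA Ax h; rewrite HA; elim/generated_ind => [|u v uE vE|u uE|u Au]; last exact: Ax.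
- by left; rewrite rho1.
- have [e e1 {}uE] := (sgn1E _ _).1 uE; have [f f1 {}vE] := (sgn1E _ _).1 vE.
  apply/sgn1E; exists (e * f); first exact: sgn1M.
  by rewrite rhoM vE rhoZ uE scalerA mulrC.
- case: uE => uE; [left|right]; first by rewrite -{1}uE rhoK.
  by rewrite -[X in rho _ X]opprK -uE rhoN rhoK.
Qed.

(** A fixed [k] in [K] moving [d] satisfies [rho k d = rho u d] up to sign for every generating
    involution [u] that moves the line of [d]. All these generators thus send [d] to the same line,
    that of [rho t d]; the others act on both lines by the same sign because they commute with [k].
    Hence sum and difference are eigenvectors. *)
Lemma moved_diagonalizable (K : set W) : generated_by_involutions H ->
  (forall k h, K k -> H h -> commute k h) ->
  (forall d, isroot d -> ~ eigen d) ->
  (forall d, isroot d -> exists2 k, K k & rho k d <> d /\ rho k d <> - d) ->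
  diagonalizable.
Proof.
move=> [A Ainv HA] comKH ned Kd d dr; right.
have AH u : A u -> H u by rewrite HA => ?; apply: sub_generated.
have Asq u : A u -> (u * u = 1)%g by move=> /Ainv[].
have [t At [td tNd]] : exists2 t, A t & rho t d <> d /\ rho t d <> - d.
  apply: contrapT => nt; apply: (ned d) => //; apply: eigen_generated HA _ => h Ah.
  apply: contrapT => hd; apply: nt; exists h => //.
  by split=> e; apply: hd; [left|right].
have Ht := AH t At.
have [k Kk [kd kNd]] := Kd d dr.
have [r rE] := isroot_refl dr.
have moved u : A u -> rho u d <> d -> rho u d <> - d ->
    exists2 e, sgn1 e & rho k d = e *: rho u d.
  move=> Au ud uNd; have Hu := AH u Au.
  have Hrur : H (r * u * r)%g.
    suff {2}-> : r = r^-1%g by apply: HJV.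
    apply/esym/mulg1_eq/(rho_faithful (R := R) (WS := WS)) => s.
    by rewrite rhoM !rE reflK ?isroot2// rho1.
  have := commute_root_image dr rE (Asq _ Au) (comKH _ _ Kk Hu) (comKH _ _ Kk Hrur) ud uNd.
  case=> // ->; [exists 1|exists (-1)]; rewrite ?scale1r ?scaleN1r//; first by left.
  by right.
have kC u x : H u -> rho u (rho k x) = rho k (rho u x).
  by move=> Hu; rewrite -!rhoM (comKH _ _ Kk Hu).
have tt x : rho t (rho t x) = x by rewrite -rhoM Asq// rho1.
have [n n1 kt] := moved t At td tNd.
have tk : rho t d = n *: rho k d by rewrite kt scalerA sgn1_sq ?scale1r.
have orbit u : A u -> exists2 e, sgn1 e &
    (rho u d = e *: d /\ rho u (rho t d) = e *: rho t d) \/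
    (rho u d = e *: rho t d /\ rho u (rho t d) = e *: d).
  move=> Au; have Hu := AH u Au.
  have [/sgn1E[e e1 ud]|und] := pselect (rho u d = d \/ rho u d = - d).
    exists e => //; left; split=> //.
    by rewrite tk rhoZ kC// ud rhoZ !scalerA mulrC.
  have [||e e1 ku] := moved u Au; [by move=> ud; apply: und; left|
    by move=> ud; apply: und; right|].
  have ud : rho u d = (e * n) *: rho t d.
    by rewrite tk -(scalerA e) !scalerA -mulrA (sgn1_sq n1) mulr1 ku scalerA (sgn1_sq e1) scale1r.
  exists (e * n); first exact: sgn1M.
  right; split=> //; rewrite {1}tk rhoZ kC// ud rhoZ -kC// kt rhoZ tt !scalerA.
  by congr (_ *: _); rewrite -[RHS]mulr1 -(sgn1_sq n1); ring.
exists (2^-1 *: (d - rho t d)), (2^-1 *: (d + rho t d)).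
apply: half_splits => //; apply: eigen_generated HA _ => u /orbit[e e1 ue];
  apply/sgn1E; case: ue => -[ud ut].
- by exists e => //; rewrite !rhoE ud ut scalerBr.
- exists (- e); last by rewrite !rhoE ud ut; vring.
  by case: e1 => ->; [right|left; rewrite opprK].
- by exists e => //; rewrite !rhoE ud ut scalerDr.
- by exists e => //; rewrite !rhoE ud ut scalerDr addrC.
Qed.

(** The reflection in [d] maps [x] to [(1 - fm x x) *: x - fm x x *: y], again an eigenvector of
    [t], so one coefficient vanishes and the norm of [x] is 0 or 1. The same holds for [y], and the
    two norms have sum 2. *)
Lemma splits_fm d x y : isroot d -> splits d x y ->
  [/\ fm x x = 1, fm y y = 1, fm x y = 0 & refl d x = - y].
Proof.
move=> dr [dE ex ey [t Ht [tx ty x0 y0]]].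
have xy : fm x y = 0.
  by have := fm_rho WS t x y; rewrite tx ty !fmE => ?; lra.
have dd := isroot2 dr; rewrite dE !fmE xy (fmC m_sym y) xy in dd.
have [r rE] := isroot_refl dr.
have tneg z : eigen z -> rho t (refl d z) = refl d z \/ rho t (refl d z) = - refl d z.
  by move=> ez; rewrite -rE; apply: (eigen_rho r ez).
have rx : refl d x = (1 - fm x x) *: x - fm x x *: y.
  by rewrite /reflection dE !fmE xy; vring.
have ry : refl d y = (1 - fm y y) *: y - fm y y *: x.
  by rewrite /reflection dE !fmE (fmC m_sym y x) xy; vring.
have xxP z : z = - z -> z = 0 :> space.
  by move=> /eqP; rewrite -addr_eq0 -mulr2n -scaler_nat scaler_eq0 pnatr_eq0 /= => /eqP.
have fx : fm x x = 1 \/ fm x x = 0.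
  have [] := tneg _ ex; rewrite rx !rhoE tx ty => h.
    left; apply/eqP; rewrite eq_sym -subr_eq0; apply/negPn/negP => c0.
    apply: x0; apply: (scalerI c0); rewrite scaler0; apply: xxP.
    by apply: (addIr (- (fm x x *: y))); rewrite -h; vring.
  right; apply/eqP/negPn/negP => c0.
  apply: y0; apply: (scalerI c0); rewrite scaler0; apply: xxP.
  by apply/esym/(addrI (- ((1 - fm x x) *: x))); rewrite -scalerN h; vring.
have fy : fm y y = 1 \/ fm y y = 0.
  have [] := tneg _ ey; rewrite ry !rhoE tx ty => h.
    right; apply/eqP/negPn/negP => c0.
    apply: x0; apply: (scalerI c0); rewrite scaler0; apply: xxP.
    by apply: (addrI ((1 - fm y y) *: y)); rewrite -h; vring.
  left; apply/eqP; rewrite eq_sym -subr_eq0; apply/negPn/negP => c0.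
  apply: y0; apply: (scalerI c0); rewrite scaler0; apply: xxP.
  apply: (addIr (fm y y *: x)).
  transitivity ((1 - fm y y) *: y - fm y y *: - x); first by vring.
  by rewrite h; vring.
have {fx fy} fx1 : fm x x = 1 by case: fx => fx //; case: fy => fy; lra.
split=> //; first by lra.
by rewrite rx fx1; vring.
Qed.

(* The reflection in [d] maps [z] to an eigenvector again, which leaves no room
   for a component of [z] orthogonal to [x]. *)
Lemma splits_uniq d x y z : isroot d -> splits d x y -> eigen z ->
  (fm z x <> 0 -> z = fm z x *: x) /\ (fm z y <> 0 -> z = fm z y *: y).
Proof.
move=> dr sd ez; have [xx yy xy dx] := splits_fm dr sd.
have [dE ex ey [t Ht [tx ty x0 y0]]] := sd.
have [r rE] := isroot_refl dr.
have tr : rho t (refl d z) = refl d z \/ rho t (refl d z) = - refl d z.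
  by rewrite -rE; apply: (eigen_rho r ez).
have rz : refl d z = z - (fm z x + fm z y) *: (x + y).
  by rewrite /reflection dE !fmE.
have zxy : fm z x = 0 \/ fm z y = 0.
  case: (ez t Ht) => tz; [left|right].
    by have := fm_rho WS t z x; rewrite tz tx !fmE => ?; lra.
  by have := fm_rho WS t z y; rewrite tz ty !fmE => ?; lra.
have half (a : R) (u v : space) : a *: u = a *: v -> a <> 0 -> u = v.
  by move=> uv /eqP a0; apply: (scalerI a0).
have half2 (u v : space) : 2 *: u = 2 *: v -> u = v.
  by move=> /half; apply; apply/eqP; rewrite pnatr_eq0.
split=> zn; case: zxy => // z0.
- have tz : rho t z = - z.
    case: (ez t Ht) => // tz; case: zn.
    by have := fm_rho WS t z x; rewrite tz tx !fmE => ?; lra.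
  case: tr; rewrite rz z0 !rhoE tz tx ty addr0 => h.
    apply: half2; apply/eqP; rewrite -subr_eq0; apply/eqP.
    transitivity (z - fm z x *: (x + y) - (- z - fm z x *: (- x + y))); first by vring.
    by rewrite h subrr.
  case: y0; apply: (half (fm z x)) => //; rewrite scaler0; apply: half2.
  transitivity (- (z - fm z x *: (x + y)) - (- z - fm z x *: (- x + y))); first by vring.
  by rewrite h subrr scaler0.
- have tz : rho t z = z.
    case: (ez t Ht) => // tz; case: zn.
    by have := fm_rho WS t z y; rewrite tz ty !fmE => ?; lra.
  case: tr; rewrite rz z0 !rhoE tz tx ty add0r => h.
    case: x0; apply: (half (fm z y)) => //; rewrite scaler0; apply: half2.
    transitivity (z - fm z y *: (- x + y) - (z - fm z y *: (x + y))); first by vring.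
    by rewrite h subrr scaler0.
  apply: half2; apply/eqP; rewrite -subr_eq0; apply/eqP.
  transitivity (z - fm z y *: (- x + y) + (z - fm z y *: (x + y))); first by vring.
  by rewrite h addNr.
Qed.

End NormalSubgroups.

(** * The orthonormal frame *)

Section Frames.
Variables (R : realType) (S : Type) (m : S -> S -> option nat).
Variables (W : groupType) (gen : S -> W).
Hypothesis WS : coxeter_system m gen.

Local Notation space := (free R {classic (S + S)}).
Local Notation root := (root R).
Local Notation fm := (bform (R := R) m).
Local Notation refl := (reflection (R := R) m).
Local Notation rho := (rho (R := R) WS).
Local Notation isroot := (isroot (R := R) WS).
Let m_sym := cox_sym WS.
Let m_pos := cox_pos WS.
Let m_diag := cox_diag WS.
Let fmE := fmE R m_sym.

Definition rcoord (x : space) (u : S) := coord x (inl u : {classic (S + S)}).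

Lemma rcoord_root s u : rcoord (root s) u = `[< s = u >]%:R.
Proof.
rewrite /rcoord coord_bas; congr (_%:R); congr nat_of_bool.
by apply/eqP/asboolP => [[]//|->].
Qed.
Lemma rcoord_rootN s u : s <> u -> rcoord (root s) u = 0.
Proof. by move=> su; rewrite rcoord_root asboolF. Qed.
Lemma rcoord_root1 s : rcoord (root s) s = 1.
Proof. by rewrite rcoord_root asboolT. Qed.
Lemma rcoordD x y u : rcoord (x + y) u = rcoord x u + rcoord y u.
Proof. by []. Qed.
Lemma rcoordN x u : rcoord (- x) u = - rcoord x u. Proof. by []. Qed.
Lemma rcoordZ k x u : rcoord (k *: x) u = k * rcoord x u. Proof. by []. Qed.

Lemma fm_simple_le0 s u : s <> u -> fm (root s) (root u) <= 0.
Proof.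
move=> su; rewrite fm_root oppr_le0; apply: mcoef_ge0; first exact: m_pos.
by move=> /m_diag.
Qed.

Lemma central_scale h e : (forall s, rho h (root s) = e *: root s) -> Defs.center W h.
Proof.
move=> he w _; apply: (rho_faithful (R := R) (WS := WS)) => s.
by rewrite !rhoM he rhoZ (span_scale _ he) //; apply/span_rho/span_root.
Qed.

(** Only the coordinate at [u] changes, so a change of sign leaves [d] no other coordinate; its norm
    then makes it [root u]. *)
Lemma refl_simple_pos u d : isroot d -> pos d -> d <> root u ->
  pos (refl (root u) d).
Proof.
move=> dr dp du; set d' := refl _ _.
have dr' : isroot d' by rewrite /d' -(rho_gen WS); apply: isroot_rho.
have [//|dn] := isroot_pos dr'; case: du.
have cE a : a <> inl u -> coord d a = 0.
  move=> au; apply/eqP; rewrite eq_le dp andbT.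
  have := dn a; rewrite coordN /d' /reflection coordD coordN coordZ coord_bas.
  case: eqP => [ua|_]; first by case: au.
  by rewrite mulr0 subr0 oppr_ge0.
have dE : d = coord d (inl u : {classic (S + S)}) *: root u.
  apply/eqP; rewrite -subr_eq0; apply/eqP; apply: coord_eq0 => a.
  rewrite coordD coordN coordZ coord_bas.
  by case: eqP => [<-|ua]; [rewrite mulr1 subrr|rewrite cE ?mulr0 ?subr0// => /esym].
have := isroot2 dr; rewrite [X in bform _ X]dE [X in bform _ _ X]dE !fmE fm_root2//.
have := dp (inl u); set k := coord _ _ in dE * => k0 k2.
by rewrite dE (_ : k = 1) ?scale1r//; nra.
Qed.

(* The coefficients of the first simple root in types B and D *)
Definition coef1 (b : bool) : R := if b then Num.sqrt 2 else 1.
Definition coef2 (b : bool) : R := if b then 0 else 1.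

Lemma coef1_gt0 b : 0 < coef1 b.
Proof. by case: b; rewrite /= ?sqrtr_gt0. Qed.
Lemma coef2_ge0 b : 0 <= coef2 b. Proof. by case: b. Qed.

(* An orthonormal basis realising the simple roots of type B ([b = true]) or D *)
Definition frame n (phi : vertex n -> S) (b : bool) (e : nat -> space) :=
  [/\ Defs.le_inf 2 n, bijective phi,
    (forall i j, (1 <= i)%N -> Defs.le_inf i n -> (1 <= j)%N -> Defs.le_inf j n ->
      fm (e i) (e j) = (i == j)%:R),
    (forall v, val v = 1%N -> root (phi v) = coef1 b *: e 1%N + coef2 b *: e 2%N)
  & (forall v, (2 <= val v)%N -> root (phi v) = e (val v) - e (val v).-1)].

Section Diagonalizable.
Variable H : set W.
Hypothesis nH : normal_subgroup H.
Hypothesis irr : irreducible m.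
Hypothesis diagH : diagonalizable R WS H.
Hypothesis ncH : ~ (H `<=` Defs.center W)%classic.

Local Notation eigen := (eigen (R := R) WS H).

(* A unit vector spanning a simultaneous eigenspace of [H] *)
Definition axis (x : space) := [/\ span x, fm x x = 1, eigen x &
  forall z, eigen z -> fm z x <> 0 -> z = fm z x *: x].

Lemma axisN x : axis x -> axis (- x).
Proof.
move=> [sx xx ex ux]; split; [exact: spanN|by rewrite !fmE xx opprK|exact: eigenN|].
move=> z ez; rewrite fmE => zx; rewrite [LHS]ux//; first by vring.
by move=> zx0; apply: zx; rewrite zx0 oppr0.
Qed.

Lemma axis_cases x z : axis x -> axis z -> [\/ fm z x = 0, z = x | z = - x].
Proof.
move=> [sx xx ex ux] [sz zz ez uz]; have [|zx] := pselect (fm z x = 0).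
  by constructor 1.
have zE := ux _ ez zx; move: zz; rewrite [X in bform _ X]zE [X in bform _ _ X]zE !fmE xx.
set k := fm z x in zE * => k2; have : (k - 1) * (k + 1) = 0 by lra.
move=> /eqP; rewrite mulf_eq0 subr_eq0 addr_eq0 => /orP[]/eqP kE.
  by constructor 2; rewrite zE kE scale1r.
by constructor 3; rewrite zE kE scaleN1r.
Qed.

Definition orthoroot d x y := [/\ d = x + y, axis x, axis y & fm x y = 0].

Lemma orthorootC d x y : orthoroot d x y -> orthoroot d y x.
Proof. by move=> [-> ax ay xy]; split; rewrite // 1?addrC// fmC. Qed.

(** The element separating the two parts sends [d] to [- x + y], so [x - y] is a root too; both axes
    then lie in the span as half sums of roots. *)
Lemma root_cases d : isroot d ->
  eigen d \/ exists x y, orthoroot d x y /\ isroot (x - y).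
Proof.
move=> dr; have [ed|[x [y sd]]] := diagH dr; [by left|right; exists x, y].
have [xx yy xy _] := splits_fm nH dr sd.
have [dE ex ey [t _ [tx ty _ _]]] := sd.
have td : rho t d = - x + y by rewrite dE rhoD tx ty.
have xyr : isroot (x - y).
  by rewrite -[_ - _]opprK opprB addrC -td; apply/isrootN/isroot_rho.
have sxy : span (x - y) by apply: isroot_span xyr.
have sd' : span d by apply: isroot_span dr.
split=> //; split=> //; split=> //.
- have -> : x = 2^-1 *: d + 2^-1 *: (x - y).
    by rewrite dE; apply: free_eq => g; rewrite !evE; field.
  by apply: spanD; apply: spanZ.
- by move=> z ez; have [] := splits_uniq nH dr sd ez.
- have -> : y = 2^-1 *: d + - (2^-1 *: (x - y)).
    by rewrite dE; apply: free_eq => g; rewrite !evE; field.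
  by apply: spanD; [apply: spanZ|apply/spanN/spanZ].
- by move=> z ez; have [] := splits_uniq nH dr sd ez.
Qed.

(** Were all simple roots eigenvectors, adjacent ones, not being orthogonal, would have the same
    sign under each [h]; by connectedness [h] would be a scalar, hence central. *)
Lemma exists_orthoroot : exists s x y, orthoroot (root s) x y /\ isroot (x - y).
Proof.
apply: contrapT => none.
have eig s : eigen (root s).
  have [//|h] := root_cases (isroot_simple R WS s).
  by case: none; exists s.
apply: ncH => h Hh.
have [[s0 _]|noS] := pselect (exists s0 : S, True); last first.
  by apply: (@central_scale h 1) => s; case: noS; exists s.
have [s [e e1 he]] : exists s, exists2 e, sgn1 e & rho h (root s) = e *: root s.
  by exists s0; apply/sgn1E/eig.
apply: (@central_scale h e) => t.
elim: (irr s t) he => [{}s {}t st hs|//|{}s u {}t _ IH1 _ IH2 /IH1/IH2//].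
have /sgn1E[f f1 ht] := eig t h Hh.
have st0 := adjacent_neq0 R st.
have := fm_rho WS h (root s) (root t); rewrite hs ht !fmE.
set c := bform _ _ _ in st0 * => ec; congr (_ *: _).
by case: e1 f1 ec => -> [] -> // ?; move/eqP: st0; case; lra.
Qed.

(* Walking along the graph, the partner [x - y] of a simple root [x + y] gets
   smaller until the end of the graph is reached. *)
Definition height (x : space) : R := ev x (fun=> 1).

(** The two shapes of the end of the graph: the edge labelled 4 of type B and the fork of type D. *)
Definition ends :=
  (exists u, eigen (root u)) \/
  (exists s u x y, orthoroot (root s) x y /\ root u = x - y).

Lemma height_ge0 x : pos x -> 0 <= height x.
Proof. by move=> px; apply: ev_ge0 => a; rewrite mulr1. Qed.

Lemma heightB x y : height (x - y) = height x - height y. Proof. by []. Qed.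
Lemma heightD x y : height (x + y) = height x + height y. Proof. by []. Qed.
Lemma height_root s : height (root s) = 1. Proof. by []. Qed.

(** A positive root of norm 2 has a positive product with some simple root [u]. Comparing axes, and
    using that distinct simple roots have products at most 0, leaves besides the two ends only
    [root u = - y + w] with a new axis [w]. Its partner [- y - w] arises from [x - y] by the
    reflections in [u] and [s], and stays positive. *)
Lemma exists_ends_bounded n s x y : orthoroot (root s) x y -> isroot (x - y) ->
  pos (x - y) -> height (x - y) < 2 * n%:R -> ends.
Proof.
elim: n s x y => [|n IH] s x y sxy dr dp hd.
  by have := height_ge0 dp; rewrite mulr0 in hd; lra.
have [sE ax ay xy] := sxy; have [sx xx ex ux] := ax; have [sy yy ey uy] := ay.
have yx : fm y x = 0 by rewrite (fmC m_sym).
have [u ud] : exists u, 0 < fm (root u) (x - y).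
  apply: contrapT => nu; have := isroot2 dr.
  have : fm (x - y) (x - y) <= 0.
    apply: span_fm_le0 => //; first exact: isroot_span dr.
    by move=> u; rewrite leNgt; apply/negP => h; apply: nu; exists u.
  by lra.
have us : u <> s by move=> us; move: ud; rewrite us sE !fmE ?xx ?yy ?xy ?yx; lra.
have [eu|] := root_cases (isroot_simple R WS u); first by left; exists u.
move=> [z0 [w0 [uzw0 _]]].
have [z [w [uzw zd]]] : exists z w, orthoroot (root u) z w /\ 0 < fm z (x - y).
  have [uE _ _ _] := uzw0; rewrite uE fmE in ud.
  have [z0d|z0d] := ltrP 0 (fm z0 (x - y)); first by exists z0, w0.
  by exists w0, z0; split; [exact: orthorootC|lra].
have [uE az aw zw] := uzw; have [sz zz ez uz] := az; have [sw ww ew uw] := aw.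
have su := fm_simple_le0 us; rewrite uE sE in su.
have fork v : root v = x - y -> ends by move=> vE; right; exists s, v, x, y.
case: (axis_cases ax az) => zx; first last.
- by case: (axis_cases ay az) => zy; move: zd; rewrite !fmE zx ?fmE xx xy; lra.
- rewrite zx in zw uE *; have wx : fm w x = 0 by rewrite (fmC m_sym).
  case: (axis_cases ay aw) => wy; first last.
  + by apply: (fork u); rewrite uE wy.
  + by move: ud; rewrite uE wy !fmE ?xx ?yy ?xy ?yx; lra.
  + by move: su; rewrite zx !fmE xx xy wx wy; lra.
case: (axis_cases ay az) => zy.
- by move: zd; rewrite !fmE zx zy; lra.
- by move: zd; rewrite !fmE zx zy yy; lra.
rewrite zy in zw uE *; rewrite !fmE in zw; have yw : fm y w = 0 by lra.
have wy : fm w y = 0 by rewrite (fmC m_sym).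
case: (axis_cases ax aw) => wx.
- have [dE1 dE2] : refl (root u) (x - y) = x - w /\ refl (root s) (x - w) = - y - w.
    have xw : fm x w = 0 by rewrite (fmC m_sym).
    by rewrite /reflection uE sE !fmE ?xx ?yy ?xy ?yx wx xw wy yw; split; vring.
  have pd1 : pos (x - w).
    rewrite -dE1; apply: refl_simple_pos => // dE.
    have : fm (x - y) x = fm (root u) x by rewrite dE.
    by rewrite uE !fmE xx yx wx; lra.
  have rd1 : isroot (x - w) by rewrite -dE1 -(rho_gen WS); apply: isroot_rho.
  have pd2 : pos (- y - w).
    rewrite -dE2; apply: refl_simple_pos => // dE.
    have : fm (x - w) y = fm (root s) y by rewrite dE.
    by rewrite sE !fmE yy xy wy; lra.
  have rd2 : isroot (- y - w) by rewrite -dE2 -(rho_gen WS); apply: isroot_rho.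
  apply: (IH u (- y) w) => //; first by split; rewrite // -?zy// zy fmNl yw oppr0.
  (* Two simple roots are subtracted, so the height drops by 2, one unit of the bound [n]. *)
  have -> : - y - w = (x - y) - (root u + root s) by rewrite uE sE; vring.
  by rewrite heightB (heightD (root u)) !height_root; rewrite -natr1 in hd; lra.
- by apply: (fork u); rewrite uE wx addrC.
- by move: ud; rewrite uE wx !fmE ?xx ?yy ?xy ?yx; lra.
Qed.

Lemma exists_ends : ends.
Proof.
have [s [x [y [sxy dr]]]] := exists_orthoroot.
have bound (z : space) : exists n, height z < 2 * n%:R.
  exists (Num.bound `|height z|).
  have := archi_boundP (normr_ge0 `|height z|); have := ler_norm (height z).
  by have := normr_ge0 (height z); rewrite normr_id; lra.
have [dp|dn] := isroot_pos dr; have [n hn] := bound (x - y).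
  exact: exists_ends_bounded sxy dr dp hn.
have [n' hn'] := bound (y - x); rewrite opprB in dn.
apply: (exists_ends_bounded (orthorootC sxy) _ dn hn').
by rewrite -opprB; apply: isrootN.
Qed.

Lemma crossing_edge (P : S -> Prop) s t : P s -> ~ P t ->
  exists u v, [/\ cox_edge m u v, P u & ~ P v].
Proof.
elim: (irr s t) => [{}s {}t st Ps Pt|//|{}s u {}t _ IH1 _ IH2 Ps Pt].
  by exists s, t.
by have [Pu|Pu] := pselect (P u); [apply: IH2|apply: IH1].
Qed.

Lemma edge_lt0 s t : cox_edge m s t -> fm (root s) (root t) < 0.
Proof.
move=> st; rewrite lt_neqAle (adjacent_neq0 R st) fm_simple_le0// => st1.
by move: st; rewrite /cox_edge st1 (m_diag t t).2.
Qed.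

(** A fork supplies its two roots. Otherwise connectedness gives an edge from a sum of two axes to
    an eigenvector, which is a multiple of one of these axes; adjacency makes the factor negative
    and the norm makes its square 2, so [e1] is minus that axis. *)
Lemma exists_start : exists b s1 s2 e1 e2, [/\ axis e1, axis e2, fm e1 e2 = 0,
  root s1 = coef1 b *: e1 + coef2 b *: e2 & root s2 = e2 - e1].
Proof.
have [[u eu]|[s [u [x [y [[sE ax ay xy] uE]]]]]] := exists_ends; last first.
  exists false, s, u, y, x; rewrite !scale1r addrC; split=> //.
  by rewrite (fmC m_sym).
have [s [x0 [y0 [sxy0 _]]]] := exists_orthoroot.
have [v [w [vw nv /contrapT ew]]] : exists v w,
    [/\ cox_edge m v w, ~ eigen (root v) & ~ ~ eigen (root w)].
  apply: (@crossing_edge _ s u) => //.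
  move=> es; have [sE ax ay xy] := sxy0.
  have [_ xx _ ux] := ax; have [_ yy _ uy] := ay.
  have : fm (root s) x0 = 1 by rewrite sE fmE xx (fmC m_sym) xy addr0.
  move=> sx; have := ux _ es; rewrite sx scale1r => sE'.
  have y00 : y0 = 0.
    apply: (addrI x0); rewrite addr0 -sE; apply: sE'.
    by apply/eqP; rewrite oner_eq0.
  by move/eqP: yy; rewrite y00 fm0l eq_sym oner_eq0.
have [//|[x1 [y1 [vxy1 _]]]] := root_cases (isroot_simple R WS v).
have [x [y [[vE ax ay xy] wx]]] : exists x y, orthoroot (root v) x y /\ fm (root w) x <> 0.
  have [h|h] := pselect (fm (root w) x1 = 0); last by exists x1, y1.
  exists y1, x1; split; first exact: orthorootC.
  have [vE _ _ _] := vxy1; have := edge_lt0 vw.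
  by rewrite (fmC m_sym) vE fmE h add0r => /[swap] ->; rewrite ltxx.
have [_ xx _ ux] := ax; have wE := ux _ ew wx.
set c := fm _ _ in wx wE; have c0 : c < 0.
  by have := edge_lt0 vw; rewrite vE wE !fmE xx (fmC m_sym y x) xy; lra.
have c2 : c ^+ 2 = 2.
  by have := fm_root2 R m_diag w; rewrite wE !fmE xx; lra.
exists true, w, v, (- x), y; split=> //; first exact: axisN.
- by rewrite fmE xy oppr0.
- rewrite wE /= scale0r addr0 scalerN -scaleNr -c2 sqrtr_sqr ltr0_norm ?opprK//.
- by rewrite vE opprK addrC.
Qed.

(** * The chain of simple roots leading away from the end of the graph *)

Section Chain.
Variables (b : bool) (s1 s2 : S) (e1 e2 : space).
Hypotheses (ax1 : axis e1) (ax2 : axis e2) (e12 : fm e1 e2 = 0).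
Hypothesis s1E : root s1 = coef1 b *: e1 + coef2 b *: e2.
Hypothesis s2E : root s2 = e2 - e1.

(** The default [s2] is only taken where the chain has no continuation, that is at indices beyond
    the rank. *)
Definition next_simple (e : space) : S :=
  xget (s2 : {classic S}) [set u : {classic S} | fm (root u) e < 0]%classic.

Fixpoint eps2 (k : nat) : space :=
  if k is j.+1 then root (next_simple (eps2 j)) + eps2 j else e2.

Definition eps (k : nat) : space := if k is j.+2 then eps2 j else e1.

Definition sig (k : nat) : S :=
  if k is j.+3 then next_simple (eps2 j) else if k is 2 then s2 else s1.

Lemma sig1E : root (sig 1) = coef1 b *: eps 1 + coef2 b *: eps 2.
Proof. exact: s1E. Qed.

Lemma sigE k : (2 <= k)%N -> root (sig k) = eps k - eps k.-1.
Proof. by case: k => [|[|[|k]]] // _; rewrite /= addrK. Qed.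

(** The third clause places the axes found so far in the span of the simple roots already used, so
    that a simple root outside the chain must involve a new axis. *)
Definition inv (k : nat) := [/\ forall i, (1 <= i <= k)%N -> axis (eps i),
  forall i j, (1 <= i <= k)%N -> (1 <= j <= k)%N -> fm (eps i) (eps j) = (i == j)%:R,
  forall i u, (1 <= i <= k)%N -> (forall j, (1 <= j <= k)%N -> sig j <> u) ->
    rcoord (eps i) u = 0
  & forall i j, (1 <= i < j)%N -> (j <= k)%N -> sig i <> sig j].

Lemma inv2 : inv 2.
Proof.
have [_ x11 _ _] := ax1; have [_ x22 _ _] := ax2.
split=> [[|[|[|i]]]//|[|[|[|i]]] // [|[|[|j]]]//= _ _|i u i2 h|[|[|i]] // [|[|[|j]]] //].
- by rewrite (fmC m_sym).
- have h1 := rcoord_rootN (h 1%N isT); have h2 := rcoord_rootN (h 2%N isT).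
  rewrite /= s1E s2E !rcoordD rcoordN !rcoordZ in h1 h2.
  have := coef1_gt0 b; have := coef2_ge0 b => q0 p0.
  have e : rcoord e2 u = rcoord e1 u by lra.
  rewrite e -mulrDl in h1; have p1 : 0 < coef1 b + coef2 b by lra.
  have h3 : rcoord e1 u = 0.
    by apply/eqP; move/eqP: h1; rewrite mulf_eq0 gt_eqF.
  by case: i i2 => [|[|[|]]]//= _; rewrite ?e h3.
- move=> _ _ s12; have := fm_root2 R m_diag s2.
  have : fm (root s1) (root s2) = fm (root s2) (root s2) by rewrite /= in s12; rewrite s12.
  rewrite fm_root2// {1}s1E s2E !fmE x11 x22 (fmC m_sym e2 e1) e12.
  by rewrite /coef1 /coef2; case: (b) => ? ?; have := coef1_gt0 true; rewrite /=; lra.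
Qed.

(** The coordinate at [u] shows that [root u] is plus or minus [eps j] plus a new axis. Its product
    with [root (sig j)] excludes the plus sign, and its product with [root (sig j.+1)] excludes
    [j < k]. *)
Lemma inv_new k u j : (2 <= k)%N -> inv k -> (forall i, (1 <= i <= k)%N -> sig i <> u) ->
  (1 <= j <= k)%N -> fm (root u) (eps j) <> 0 ->
  j = k /\ exists z, [/\ axis z, root u = z - eps k &
    forall i, (1 <= i <= k)%N -> fm z (eps i) = 0].
Proof.
move=> k2 [iax ifm ico _] new jk uj.
have u1 := rcoord_root1 u.
have [eu|[x0 [y0 [uxy0 _]]]] := root_cases (isroot_simple R WS u).
  have [_ _ _ uniq] := iax j jk; have := rcoord_root1 u.
  by rewrite (uniq _ eu uj) rcoordZ ico// mulr0 => /eqP; rewrite eq_sym oner_eq0.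
have [x [y [[uE ax ay xy] xj]]] : exists x y, orthoroot (root u) x y /\ fm x (eps j) <> 0.
  have [h|h] := pselect (fm x0 (eps j) = 0); last by exists x0, y0.
  exists y0, x0; split; first exact: orthorootC.
  by have [uE _ _ _] := uxy0; rewrite uE fmE h add0r in uj.
have [c c1 xE] : exists2 c : R, c = 1 \/ c = -1 & x = c *: eps j.
  case: (axis_cases (iax j jk) ax) => // ->.
    by exists 1; rewrite ?scale1r//; left.
  by exists (-1); rewrite ?scaleN1r//; right.
have yi i : (1 <= i <= k)%N -> fm y (eps i) = 0.
  move=> ik; case: (axis_cases (iax i ik) ay) => // yE; exfalso; move: u1.
    by rewrite uE xE yE rcoordD rcoordZ !ico//; lra.
  by rewrite uE xE yE rcoordD rcoordZ rcoordN !ico//; lra.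
have ui i : (1 <= i <= k)%N -> fm (root u) (eps i) = c * (j == i)%:R.
  by move=> ik; rewrite uE xE fmDl fmZl yi// ifm// addr0.
have le0 i : (1 <= i <= k)%N -> fm (root u) (root (sig i)) <= 0.
  by move=> ik; apply: fm_simple_le0 => /esym; apply: new.
have c0 : c <= 0.
  have := le0 j jk; have [j1|j1] := eqVneq j 1%N.
    rewrite j1 sig1E !fmE !ui ?j1//; [have := coef1_gt0 b; rewrite /=|lia].
    by case: c1 => ->; lra.
  have j2 : (2 <= j)%N by lia.
  rewrite sigE// !fmE !ui//; last by lia.
  have -> : (j == j.-1) = false by lia.
  by rewrite eqxx /=; lra.
have {}c1 : c = -1 by case: c1 c0 => // ->; lra.
have jkE : j = k.
  apply/eqP/negPn/negP => jnk; have jS : (1 <= j.+1 <= k)%N by lia.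
  have := le0 j.+1 jS; rewrite sigE ?fmE ?ui//=; last by lia.
  have -> : (j == j.+1) = false by lia.
  by rewrite c1 eqxx /=; lra.
split=> //; exists y; split=> //; last by rewrite uE xE c1 jkE scaleN1r addrC.
Qed.

(** The chain does not branch: orthogonal [z] and [t] would give two simple roots with product 1,
    and [z = - t] is excluded by the coordinates at [u]. *)
Lemma inv_uniq k u v z t : inv k -> (1 <= k)%N ->
  (forall i, (1 <= i <= k)%N -> sig i <> u) ->
  axis z -> axis t -> root u = z - eps k -> root v = t - eps k ->
  fm z (eps k) = 0 -> fm t (eps k) = 0 -> u = v.
Proof.
move=> [iax ifm ico _] k1 new az at' uE vE zk tk; apply: contrapT => uv.
have kk : (1 <= k <= k)%N by lia.
have := fm_simple_le0 uv; rewrite uE vE !fmE zk (fmC m_sym (eps k) t) tk ifm// eqxx.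
case: (axis_cases at' az) => zt; first by rewrite zt /=; lra.
  by case: uv; have := rcoord_root1 u; rewrite uE zt -vE rcoord_root; case: asboolP => // _ /eqP;
    rewrite eq_sym oner_eq0.
have := rcoord_root1 u; have : rcoord (root v) u = 0 by apply: rcoord_rootN => /esym.
rewrite uE vE zt !rcoordD !rcoordN ico//; lra.
Qed.

Definition stepable k := exists u, fm (root u) (eps k) < 0.

Lemma fm_sig_ge0 k i : (2 <= k)%N -> inv k -> (1 <= i <= k)%N ->
  0 <= fm (root (sig i)) (eps k).
Proof.
move=> k2 [_ ifm _ _] ik; have [->|i1] := eqVneq i 1%N.
  rewrite sig1E !fmE !ifm ?addr_ge0 ?mulr_ge0 ?ler0n//; try lia.
    exact/ltW/coef1_gt0.
  exact: coef2_ge0.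
rewrite sigE ?fmE ?ifm//; try lia.
by have -> : (i.-1 == k) = false; [lia|rewrite mulr0n subr0 ler0n].
Qed.

Lemma sig_step k : (2 <= k)%N -> stepable k -> fm (root (sig k.+1)) (eps k) < 0.
Proof.
case: k => [|[|k]] // _ [u uk]; rewrite /sig /next_simple.
by apply: (@xgetPex {classic S} s2 [set v | fm (root v) (eps2 k) < 0]%classic); exists u.
Qed.

Lemma inv_step k : (2 <= k)%N -> inv k -> stepable k -> inv k.+1.
Proof.
move=> k2 ik sk; have su := sig_step k2 sk; set u := sig k.+1 in su.
have new i : (1 <= i <= k)%N -> sig i <> u.
  by move=> ki iu; have := fm_sig_ge0 k2 ik ki; rewrite iu; lra.
have kk : (1 <= k <= k)%N by lia.
have un : fm (root u) (eps k) <> 0 by move=> u0; move: su; rewrite u0 ltxx.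
have [_ [z [az uE zi]]] := inv_new k2 ik new kk un.
have zE : eps k.+1 = z.
  by have := sigE (leqW k2); rewrite -/u uE /= => /addIr.
have [iax ifm ico isg] := ik.
have zz : fm z z = 1 by have [] := az.
have cases i : (1 <= i <= k.+1)%N -> i = k.+1 \/ (1 <= i <= k)%N.
  by move=> ?; have [->|?] := eqVneq i k.+1; [left|right; lia].
split=> [i /cases[->|/iax//]|i j /cases[->|ii] /cases[->|jj]|i v /cases[->|ii] h|i j ij].
- by rewrite zE.
- by rewrite zE zz eqxx.
- by rewrite zE zi//; have -> : (k.+1 == j) = false by lia.
- by rewrite zE (fmC m_sym) zi//; have -> : (i == k.+1) = false by lia.
- exact: ifm.
- have -> : eps k.+1 = root u + eps k by rewrite zE uE subrK.
  rewrite rcoordD ico ?rcoord_rootN ?addr0//; first by apply: h; lia.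
  by move=> j jk; apply: h; lia.
- by apply: ico => // j jk; apply: h; lia.
move=> jk; have [->|jk'] := eqVneq j k.+1; first by apply: new; lia.
by apply: isg => //; lia.
Qed.

Definition last_index (k : nat) : bool := `[< (2 <= k)%N /\ ~ stepable k >].

Definition rank : option nat :=
  if pselect (exists k, last_index k) is left h then Some (ex_minn h) else None.

Lemma rank_stepable k : (2 <= k)%N -> Defs.le_inf k.+1 rank -> stepable k.
Proof.
move=> k2; rewrite /rank; case: pselect => [h|nh] /=.
  case: ex_minnP => N _ Nmin kN; apply: contrapT => nk.
  by have := Nmin k; rewrite leqNgt kN => /implyP; rewrite implybF => /asboolP[].
by move=> _; apply: contrapT => nk; apply: nh; exists k; apply/asboolP.
Qed.

Lemma rank_last k : (2 <= k)%N -> Defs.le_inf k rank -> stepable k -> Defs.le_inf k.+1 rank.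
Proof.
move=> k2; rewrite /rank; case: pselect => [h|nh] //=.
case: ex_minnP => N /asboolP[N2 nN] _; rewrite leq_eqVlt => /orP[/eqP kN|//] sk.
by rewrite kN in sk.
Qed.

Lemma rank_ge2 : Defs.le_inf 2 rank.
Proof.
by rewrite /rank; case: pselect => [h|nh] //=; case: ex_minnP => N /asboolP[].
Qed.

Lemma le_inf_leq i j n : (i <= j)%N -> Defs.le_inf j n -> Defs.le_inf i n.
Proof. by case: n => //= p; apply: leq_trans. Qed.

Lemma rank_inv k : (2 <= k)%N -> Defs.le_inf k rank -> inv k.
Proof.
elim: k => // k IH k2 kr; have [k1|k1] := eqVneq k 1%N; first by rewrite k1; exact: inv2.
have k2' : (2 <= k)%N by lia.
apply: inv_step => //; last exact: rank_stepable.
by apply: IH => //; apply: le_inf_leq kr.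
Qed.

(** By connectedness an uncovered simple root may be taken adjacent to the chain. It is then not
    orthogonal to some axis, so it continues the chain at its last index, where the continuation is
    unique. *)
Lemma sig_cover u : exists i, [/\ (1 <= i)%N, Defs.le_inf i rank & sig i = u].
Proof.
apply: contrapT => nu.
pose P v := exists i, [/\ (1 <= i)%N, Defs.le_inf i rank & sig i = v].
have P1 : P (sig 1) by exists 1%N; split=> //; apply: le_inf_leq rank_ge2.
have [v [{}u [vu [i [i1 ir iv]] {}nu]]] := crossing_edge P1 nu; rewrite -iv in vu.
(* The first simple root may involve [eps 2], so at least two axes are taken. *)
pose k := maxn i 2.
have k2 : (2 <= k)%N by rewrite leq_maxr.
have kr : Defs.le_inf k rank.
  by rewrite /k; case: (leqP i 2) => _; [exact: rank_ge2|].
have ik := rank_inv k2 kr.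
have new j : (1 <= j <= k)%N -> sig j <> u.
  by move=> jk ju; apply: nu; exists j; split=> //; [lia|apply: le_inf_leq kr; lia].
have [j [jk uj]] : exists j, (1 <= j <= k)%N /\ fm (root u) (eps j) <> 0.
  apply: contrapT => nj.
  have u0 j : (1 <= j <= k)%N -> fm (root u) (eps j) = 0.
    by move=> jk; apply: contrapT => uj; apply: nj; exists j.
  have := edge_lt0 vu; rewrite (fmC m_sym); have [i1'|i1'] := eqVneq i 1%N.
    by rewrite i1' sig1E !fmE !u0 ?mulr0 ?addr0 ?ltxx//; lia.
  by rewrite sigE ?fmE ?u0 ?subr0 ?ltxx//; rewrite /k; lia.
have [_ [z [az uE zi]]] := inv_new k2 ik new jk uj.
have kk : (1 <= k <= k)%N by lia.
have [iax ifm _ _] := ik.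
have uk : fm (root u) (eps k) = -1.
  by rewrite uE !fmE zi// ifm// eqxx sub0r.
have sk : stepable k by exists u; rewrite uk ltrN10.
have kr' := rank_last k2 kr sk.
have su := sig_step k2 sk.
have new' j' : (1 <= j' <= k)%N -> sig j' <> sig k.+1.
  move=> jk' ju; have [_ _ _ isg] := rank_inv (leqW k2) kr'.
  by apply: (isg j' k.+1) ju; lia.
have sun : fm (root (sig k.+1)) (eps k) <> 0.
  by move=> u0; move: su; rewrite u0 ltxx.
have [_ [t [at' u'E ti]]] := inv_new k2 ik new' kk sun.
apply: nu; exists k.+1; split=> //; apply/esym.
by apply: (inv_uniq ik _ new az at' uE u'E); [lia|exact: zi|exact: ti].
Qed.

Definition chain_vertex (v : vertex rank) : S := sig (val v).

Lemma chain_vertex_bij : bijective chain_vertex.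
Proof.
have inj v w : chain_vertex v = chain_vertex w -> v = w.
  rewrite /chain_vertex => vw; apply: val_inj; apply: contrapT => /eqP vwN.
  wlog lt : v w vw vwN / (val v < val w)%N.
    move=> h; case: (ltngtP (val v) (val w)) vwN => // lt _.
      by apply: (h v w) => //; rewrite ltn_eqF.
    by apply: (h w v) => //; rewrite ltn_eqF.
  case: v w lt vw {vwN} => [i /= /andP[i1 ir]] [j /= /andP[j1 jr]] lt.
  have j2 : (2 <= j)%N by lia.
  have [_ _ _ isg] := rank_inv j2 jr.
  by apply: isg => //; rewrite i1 lt.
pose g u := let: exist i h := cid (sig_cover u) in
  let: And3 h1 h2 _ := h in exist (fun i => (1 <= i)%N && Defs.le_inf i rank) i
    (introT andP (conj h1 h2)) : vertex rank.
have gK u : chain_vertex (g u) = u.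
  by rewrite /g; case: (cid _) => i [h1 h2 h3].
by exists g => // v; apply: inj; rewrite gK.
Qed.

Lemma chain_frame : frame chain_vertex b eps.
Proof.
split; [exact: rank_ge2|exact: chain_vertex_bij| | |].
- move=> i j i1 ir j1 jr.
  have [k2 kr] : (2 <= maxn 2 (maxn i j))%N /\ Defs.le_inf (maxn 2 (maxn i j)) rank.
    split; first by rewrite leq_maxl.
    by have := rank_ge2; move: ir jr; case: (rank) => //= p; rewrite !geq_max => -> -> ->.
  by have [_ ifm _ _] := rank_inv k2 kr; apply: ifm; lia.
- by move=> v v1; rewrite /chain_vertex v1 sig1E.
- by move=> v v2; rewrite /chain_vertex sigE.
Qed.

Lemma chain_eigen i : (1 <= i)%N -> Defs.le_inf i rank -> eigen (eps i).
Proof.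
move=> i1 ir.
have [k2 kr] : (2 <= maxn 2 i)%N /\ Defs.le_inf (maxn 2 i) rank.
  split; first by rewrite leq_maxl.
  by have := rank_ge2; move: ir; case: (rank) => //= p; rewrite !geq_max => -> ->.
have [iax _ _ _] := rank_inv k2 kr.
have ii : (1 <= i <= maxn 2 i)%N by rewrite i1 leq_maxr.
by have [] := iax i ii.
Qed.

End Chain.

Lemma exists_frame : exists n (phi : vertex n -> S) b e, frame phi b e /\
  forall i, (1 <= i)%N -> Defs.le_inf i n -> eigen (e i).
Proof.
have [b [s1 [s2 [e1 [e2 [ax1 ax2 e12 s1E s2E]]]]]] := exists_start.
exists (rank s2 e1 e2), (@chain_vertex s1 s2 e1 e2), b, (eps s2 e1 e2).
split; first exact: chain_frame.
by move=> i i1 ir; apply: (chain_eigen ax1 ax2 e12 s1E s2E).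
Qed.

End Diagonalizable.
End Frames.

(** * Frames and Coxeter graphs *)

(* The Coxeter matrix of type B ([b = true]) or D *)
Definition bd_nat (b : bool) (i j : nat) : option nat :=
  if i == j then Some 1%N
  else if b then
    (if edgeB i j || edgeB j i then (if minn i j == 1 then Some 4 else Some 3) else Some 2)%N
  else (if edgeD i j || edgeD j i then Some 3%N else Some 2%N).

Definition mat_bd b n (x y : vertex n) := bd_nat b (val x) (val y).

Lemma mat_bdE b n : mat_bd b (n := n) = if b then @matB n else @matD n.
Proof. by case: b; apply/funext => x; apply/funext => y. Qed.

Section GramBD.
Variable R : realType.

(* The product of the [i]-th and [j]-th simple roots, for [i < j] *)
Definition bd_gram (b : bool) (i j : nat) : R :=
  if i == 1%N then coef2 R b * ((2%N == j)%:R - (2%N == j.-1)%:R) - coef1 R b * (1%N == j.-1)%:R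
  else - (i == j.-1)%:R.

(* The product of the [i]-th vector of a frame with the [j]-th simple root *)
Definition bd_coef (b : bool) (i j : nat) : R :=
  if j == 1%N then coef1 R b * (i == 1%N)%:R + coef2 R b * (i == 2%N)%:R
  else (i == j)%:R - (i == j.-1)%:R.

(** This and the next two identities are the induction step for the products of [e i.+1], the sum of
    [e i] and the simple root number [i.+1], with the simple root number [j]. *)
Lemma bd_coef_lt b i j : (1 <= j)%N -> (j < i.+1)%N ->
  bd_coef b i j + bd_gram b j i.+1 = bd_coef b i.+1 j.
Proof.
move=> j1 ji; rewrite /bd_coef /bd_gram /=; have [_|jN] := eqVneq j 1%N.
  have -> : (i.+1 == 1%N) = false by lia.
  by rewrite [2%N == i.+1]eq_sym [2%N == i]eq_sym [1%N == i]eq_sym /=; ring.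
have -> : (i == j.-1) = false by lia.
have -> : (i.+1 == j) = false by lia.
have -> : (i.+1 == j.-1) = false by lia.
by rewrite [j == i]eq_sym /=; ring.
Qed.

Lemma bd_coef_gt b i j : (1 <= i)%N -> (i.+1 < j)%N ->
  bd_coef b i j + bd_gram b i.+1 j = bd_coef b i.+1 j.
Proof.
move=> i1 ij; rewrite /bd_coef /bd_gram.
have -> : (j == 1%N) = false by lia.
have -> : (i.+1 == 1%N) = false by lia.
have -> : (i == j) = false by lia.
have -> : (i.+1 == j) = false by lia.
have -> : (i == j.-1) = false by lia.
by rewrite /=; ring.
Qed.

Lemma bd_coef_eq b i : (1 <= i)%N -> bd_coef b i i.+1 + 2 = bd_coef b i.+1 i.+1.
Proof.
move=> i1; rewrite /bd_coef /=; have -> : (i.+1 == 1%N) = false by lia.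
have -> : (i == i.+1) = false by lia.
have -> : (i.+1 == i) = false by lia.
by rewrite !eqxx /=; ring.
Qed.

Lemma bd_nat_gram b i j : (1 <= i)%N -> (i < j)%N ->
  - mcoef R (bd_nat b i j) = bd_gram b i j.
Proof.
rewrite /bd_gram.
move=> i1 ij; have cond : bd_nat b i j =
    if b then if j == i.+1 then (if i == 1 then Some 4 else Some 3)%N else Some 2%N
    else if (((i == 1) && (j == 3)) || ((2 <= i) && (j == i.+1)))%N then Some 3%N else Some 2%N.
  rewrite /bd_nat /edgeB /edgeD; have -> : (i == j) = false by lia.
  have -> : minn i j = i by lia.
  by case: b; congr (if _ then _ else _); lia.
have sq2 : mcoef R (Some 4%N) = Num.sqrt 2.
  rewrite -mcoef4 sqrtr_sqr ger0_norm//.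
  by have /andP[] := @mcoef_bounds R 4 isT.
have e12 : (2%N == j.-1) = (j == 3%N) by lia.
have e11 : (1%N == j.-1) = (j == 2%N) by lia.
have eij : (i == j.-1) = (j == i.+1) by lia.
rewrite {}cond e12 e11 eij [2%N == j]eq_sym /coef1 /coef2; case: b.
  case: (i =P 1%N) => [->|i1'] /=.
    by case: (j =P 2%N) => [->|_] /=; rewrite ?sq2 ?mcoef2; lra.
  by case: (j =P i.+1) => [_|_] /=; rewrite ?mcoef3 ?mcoef2; lra.
case: (i =P 1%N) => [->|i1'] /=.
  case: (j =P 3%N) => [->|j3] /=; first by rewrite mcoef3; lra.
  by rewrite mcoef2; case: (j == 2%N) => /=; lra.
have -> : (1 < i)%N by lia.
by case: eqP => // _; rewrite ?mcoef3 ?mcoef2.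
Qed.

Lemma bd_natC b i j : bd_nat b i j = bd_nat b j i.
Proof.
rewrite /bd_nat eq_sym minnC.
by rewrite (orbC (edgeB i j)) (orbC (edgeD i j)).
Qed.

Lemma bd_nat2 b i : - mcoef R (bd_nat b i i) = 2.
Proof. by rewrite /bd_nat eqxx mcoef1 opprK. Qed.

Lemma bd_nat_cases b i j : i != j ->
  exists2 k, (2 <= k <= 4)%N & bd_nat b i j = Some k.
Proof.
rewrite /bd_nat => /negPf ->.
case: b; case: ifP => _; [case: ifP => _|..];
  by [exists 4%N|exists 3%N|exists 2%N].
Qed.

End GramBD.

Lemma le_inf_max i j n : Defs.le_inf i n -> Defs.le_inf j n -> Defs.le_inf (maxn i j) n.
Proof. by case: leqP. Qed.

Section FramesAndGraphs.
Variables (R : realType) (S : Type) (m : S -> S -> option nat).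
Variables (W : groupType) (gen : S -> W).
Hypothesis WS : coxeter_system m gen.

Local Notation space := (free R {classic (S + S)}).
Local Notation root := (root R).
Local Notation fm := (bform (R := R) m).
Let m_sym := cox_sym WS.
Let m_pos := cox_pos WS.
Let m_diag := cox_diag WS.
Let fmE := fmE R m_sym.
Variables (n : option nat) (phi : vertex n -> S) (b : bool).

(** A graph isomorphism speaks of edges only; elsewhere the exponent is 1 on the diagonal and must
    be 2 off it. *)
Lemma iso_matrix : graph_iso (mat_bd b (n := n)) m phi ->
  forall v w, m (phi v) (phi w) = mat_bd b v w.
Proof.
move=> [[g pK gK] phiE phil] v w; have [edge|nedge] := pselect (cox_edge (mat_bd b (n:=n)) v w).
  exact: phil.
have {phiE phil} : ~ cox_edge m (phi v) (phi w) by move=> /phiE.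
move: nedge; rewrite /cox_edge; have [->|vw] := eqVneq v w.
  by rewrite (m_diag _ _).2// /mat_bd /bd_nat eqxx.
have [k k24 ->] : exists2 k, (2 <= k <= 4)%N & mat_bd b v w = Some k.
  by apply: bd_nat_cases.
have m0 := @m_pos (phi v) (phi w).
have m1 : m (phi v) (phi w) <> Some 1%N.
  by move=> /m_diag /(can_inj pK) vwE; rewrite vwE eqxx in vw.
case: (m _ _) m0 m1 => [[|[|[|j]]]|] //= _ _ k3 _; congr Some.
by move: k3 k24; case: k => [|[|[|]]].
Qed.

Lemma matrix_iso : bijective phi -> (forall v w, m (phi v) (phi w) = mat_bd b v w) ->
  graph_iso (mat_bd b (n := n)) m phi.
Proof. by move=> phib phim; split=> // v w; rewrite /cox_edge phim. Qed.

(** The frame determines the products of simple roots, hence the cosines, and by [mcoef_eq] the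
    exponents. *)
Lemma frame_matrix (e : nat -> space) : frame m phi b e ->
  forall v w, m (phi v) (phi w) = mat_bd b v w.
Proof.
move=> [n2 phib efm r1 r2].
have le_inf_v (v : vertex n) : (1 <= val v)%N /\ Defs.le_inf (val v) n.
  by case: v => i /= /andP[].
have ve i j : (1 <= i)%N -> (1 <= j)%N -> forall v : vertex n, (maxn 2 (val v)) = (maxn (maxn 2 (val v)) (maxn i j)) ->
    fm (e i) (e j) = (i == j)%:R.
  move=> i1 j1 v vij; have [_ vn] := le_inf_v v.
  have mx := le_inf_max n2 vn.
  by apply: efm => //; apply: le_inf_leq mx; rewrite vij; lia.
suff h v w : (val v < val w)%N -> m (phi v) (phi w) = mat_bd b v w.
  move=> v w; have [vw|vw|/val_inj ->] := ltngtP (val v) (val w); first exact: h.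
    by rewrite m_sym h// /mat_bd bd_natC.
  by rewrite (m_diag _ _).2// /mat_bd /bd_nat eqxx.
move=> vw; have [v1 _] := le_inf_v v.
have vNw : val v != val w by lia.
have [k k24 kE] := bd_nat_cases b vNw.
rewrite [RHS]kE; apply: (@mcoef_eq R) => //; first by move=> /m_diag; case: phib => g gK _ /(can_inj gK) vwE; rewrite vwE ltnn in vw.
apply: oppr_inj; rewrite -fm_root -kE bd_nat_gram// /bd_gram.
set i := val v in vw v1 vNw kE *; set j := val w in vw vNw kE *.
have efm' a c : (1 <= a <= maxn 2 j)%N -> (1 <= c <= maxn 2 j)%N ->
    fm (e a) (e c) = (a == c)%:R.
  by move=> aj cj; apply: (ve a c _ _ w); rewrite -?/j; lia.
have j2 : (2 <= j)%N by lia.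
rewrite (r2 w) -/j//; have [i1|i1] := eqVneq i 1%N.
  rewrite (r1 v)// !fmE !efm'; try lia.
  by have -> : (1%N == j) = false; [lia|rewrite /=; ring].
rewrite (r2 v) -/i ?fmE ?efm'; try lia.
have -> : (i == j) = false by lia.
have -> : (i.-1 == j) = false by lia.
have -> : (i.-1 == j.-1) = false by lia.
by rewrite /=; ring.
Qed.

(** In rank 2 the fork consists of two vertices without an edge, which is not connected. *)
Lemma frameD_rank : irreducible m -> b = false -> forall e : nat -> space, frame m phi b e ->
  Defs.le_inf 3 n.
Proof.
move=> irr bF e fr; have [n2 phib _ _ _] := fr; have phim := frame_matrix fr.
case En : n => [p|] //=; rewrite ltnNge; apply/negP => p2.
have pE : p = 2%N by move: n2; rewrite En /= => ?; lia.
have h1 : (1 <= 1)%N && Defs.le_inf 1 n by rewrite En pE.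
have h2 : (1 <= 2)%N && Defs.le_inf 2 n by rewrite En pE.
pose v1 : vertex n := exist _ 1%N h1; pose v2 : vertex n := exist _ 2%N h2.
have n12 : v1 <> v2 by move=> /(congr1 val).
have [g gK Kg] := phib.
have [u [w [vw uE wN]]] := @crossing_edge S m irr (fun s => s = phi v1) (phi v1) (phi v2)
  erefl (fun h => n12 (can_inj gK (esym h))).
move: vw; rewrite uE -(Kg w) /cox_edge phim /mat_bd bF.
have i1 : val (g w) <> 1%N.
  by move=> h; apply: wN; rewrite -[phi v1]/(phi v1) -(Kg w); congr phi; apply: val_inj.
have i2 : val (g w) = 2%N.
  have [j1 j2] : (1 <= val (g w))%N /\ Defs.le_inf (val (g w)) (Some p).
    by rewrite -En; case: (g w) => i /= /andP[].
  by move: i1 j1 j2; rewrite pE; move: (val (g w)) => x /=; lia.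
by rewrite i2.
Qed.

Lemma matrix_frame : Defs.le_inf 2 n -> bijective phi ->
  (forall v w, m (phi v) (phi w) = mat_bd b v w) -> exists e : nat -> space, frame m phi b e.
Proof.
move=> n2 phib phim.
pose r i := if insub i is Some v then root (phi v) else 0.
have rE (v : vertex n) : r (val v) = root (phi v) by rewrite /r valK.
pose ok i := (1 <= i)%N && Defs.le_inf i n.
have rfm i j : ok i -> ok j -> fm (r i) (r j) = - mcoef R (bd_nat b i j).
  move=> iok jok; pose v : vertex n := exist _ i iok; pose w : vertex n := exist _ j jok.
  by rewrite (rE v) (rE w) fm_root phim.
have rii i : ok i -> fm (r i) (r i) = 2 by move=> iok; rewrite rfm// bd_nat2.
have rij i j : ok i -> ok j -> (i < j)%N -> fm (r i) (r j) = bd_gram R b i j.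
  by move=> iok jok ij; rewrite rfm// bd_nat_gram//; case/andP: iok.
(* This solves [r 1 = sqrt 2 e 1] in type B, and [r 1 = e 1 + e 2], [r 2 = e 2 - e 1] in type D. *)
pose e1 := if b then (Num.sqrt 2)^-1 *: r 1%N else 2^-1 *: (r 1%N - r 2%N).
pose e := fix e i := if i is j.+1 then (if j is 0 then e1 else e j + r j.+1) else 0.
have eS i : (1 <= i)%N -> e i.+1 = e i + r i.+1 by case: i.
have e1E : e 1%N = e1 by [].
clearbody e.
have okS i : ok i.+1 -> (1 <= i)%N -> ok i.
  by move=> /andP[_ h] i1; rewrite /ok i1 (le_inf_leq _ h).
have ok1 : ok 1%N by rewrite /ok (le_inf_leq _ n2).
have ok2 : ok 2%N by rewrite /ok n2.
have s2 : Num.sqrt 2 * Num.sqrt 2 = 2 :> R by rewrite -expr2 sqr_sqrtr.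
have s0 : Num.sqrt 2 != 0 :> R by rewrite gt_eqF// sqrtr_gt0.
have e1r j : ok j -> fm e1 (r j) = bd_coef R b 1 j.
  move=> jok; have j1 : (1 <= j)%N by case/andP: jok.
  rewrite /e1; have [j1'|j1'] := eqVneq j 1%N.
    rewrite j1' /bd_coef; case: (b) rij => /= rij; rewrite !fmE rii//.
      by rewrite -{2}s2 mulKf//; ring.
    by rewrite (fmC m_sym (r 2%N)) rij//= /bd_gram /=; lra.
  have j2 : (2 <= j)%N by lia.
  have h1 : (1%N == j) = false by lia.
  have h2 : (2%N == j.-1) = (3%N == j) by lia.
  case: (b) rij => /= rij; rewrite !fmE rij//=.
    rewrite /bd_gram /bd_coef (negPf j1') h1 /= mul0r !sub0r mulrN.
    by rewrite mulKf.
  have [->|j2'] := eqVneq j 2%N; first by rewrite rii//= /bd_gram /bd_coef /=; lra.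
  have h3 : (1%N == j.-1) = false by lia.
  rewrite rij//; last by lia.
  rewrite /bd_gram /bd_coef (negPf j1') h1 h3 [2%N == j]eq_sym (negPf j2') /=.
  by lra.
have er i j : ok i -> ok j -> fm (e i) (r j) = bd_coef R b i j.
  elim: i => [|i IH] iok jok; first by case/andP: iok.
  have j1 : (1 <= j)%N by case/andP: jok.
  have [->|i0] := eqVneq i 0%N; first by rewrite e1E e1r.
  have i1 : (1 <= i)%N by rewrite lt0n.
  have iok' := okS i iok i1.
  rewrite eS// fmDl IH//; case: (ltngtP j i.+1) => ji.
  - by rewrite (fmC m_sym (r i.+1)) rij// bd_coef_lt.
  - by rewrite rij// bd_coef_gt.
  - by rewrite ji rii// bd_coef_eq.
have ee i j : ok i -> ok j -> fm (e i) (e j) = (i == j)%:R.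
  move=> iok; elim: j => [|j IH] jok; first by case/andP: jok.
  have [->|j0] := eqVneq j 0%N.
    rewrite e1E /e1.
    have := er i 1%N iok ok1; have := er i 2%N iok ok2.
    rewrite /bd_coef /coef1 /coef2 /=; case: (b) => ei2 ei1.
      by rewrite (fmZr m_sym) ei1 mul0r addr0 mulrA mulVf// mul1r.
    by rewrite (fmZr m_sym) (fmDr m_sym) (fmNr m_sym) ei1 ei2; lra.
  have j1 : (1 <= j)%N by rewrite lt0n.
  have jok' := okS j jok j1.
  rewrite eS// (fmDr m_sym) IH// er// /bd_coef /= eqSS (negPf j0).
  by ring.
exists e; split=> //.
- by move=> i j i1 ir j1 jr; apply: ee; rewrite /ok ?i1 ?j1.
- move=> v v1; rewrite -rE v1 (eS 1%N)// e1E.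
  rewrite /e1 /coef1 /coef2; case: (b); apply: free_eq => g; rewrite !evE.
    by field.
  by field.
- move=> v v2; rewrite -rE; case: (val v) v2 => // j j1.
  by rewrite eS//= addrC addKr.
Qed.

End FramesAndGraphs.

(** * Groups of sign changes *)

Section FlipWords.
Variables (W : groupType) (b : bool) (g : nat -> W).

(* In type B, [flip i] changes the sign of the [i]-th coordinate; in type D, it
   changes the signs of the coordinates 1 and [i], and [flip 1] is trivial. *)
Fixpoint flip (i : nat) : W :=
  match i with
  | 0 => 1
  | j.+1 => match j with
            | 0 => if b then g 1%N else 1
            | 1 => if b then g 2%N * flip j * g 2%N else g 1%N * g 2%N
            | _ => g i * flip j * g i
            end
  end%g.

Fixpoint flips (k : nat) : W := (if k is j.+1 then flips j * flip k else 1)%g.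

Lemma flip1E : flip 1 = if b then g 1%N else 1%g. Proof. by []. Qed.
Lemma flip2E : flip 2 = (if b then g 2%N * flip 1 * g 2%N else g 1%N * g 2%N)%g.
Proof. by []. Qed.
Lemma flipSE i : flip i.+3 = (g i.+3 * flip i.+2 * g i.+3)%g. Proof. by []. Qed.
Lemma flipsS k : flips k.+1 = (flips k * flip k.+1)%g. Proof. by []. Qed.

End FlipWords.
Arguments flip : simpl never.
Arguments flips : simpl never.

Lemma multiplicative1 (G G' : groupType) (f : {multiplicative G -> G'}) : f 1%g = 1%g.
Proof. by apply: (mulgI (f 1%g)); rewrite -gmulfM !mulg1. Qed.

Lemma multiplicativeV (G G' : groupType) (f : {multiplicative G -> G'}) x :
  f x^-1%g = (f x)^-1%g.
Proof. by apply/esym/mulg1_eq; rewrite -gmulfM mulgV multiplicative1. Qed.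

Lemma flip_morph (G G' : groupType) (f : {multiplicative G -> G'}) b g g' i :
  (forall i, f (g i) = g' i) -> f (flip b g i) = flip b g' i.
Proof.
move=> fg; elim: i => [|[|[|i]] IH].
- exact: multiplicative1.
- by rewrite !flip1E; case: (b); rewrite ?fg ?multiplicative1.
- by rewrite !flip2E; case: (b) IH => IH; rewrite !gmulfM !fg ?IH.
- by rewrite !flipSE !gmulfM !fg IH.
Qed.

Lemma flips_morph (G G' : groupType) (f : {multiplicative G -> G'}) b g g' k :
  (forall i, f (g i) = g' i) -> f (flips b g k) = flips b g' k.
Proof.
move=> fg; elim: k => [|k IH]; first exact: multiplicative1.
by rewrite !flipsS gmulfM IH (flip_morph b k.+1 fg).
Qed.

Section SignChanges.
Variables (R : realType) (S : Type) (m : S -> S -> option nat).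
Variables (W : groupType) (gen : S -> W).
Hypothesis WS : coxeter_system m gen.

Local Notation space := (free R {classic (S + S)}).
Local Notation fm := (bform (R := R) m).
Local Notation rho := (rho (R := R) WS).
Let m_sym := cox_sym WS.
Let m_pos := cox_pos WS.
Let m_diag := cox_diag WS.
Let fmE := fmE R m_sym.
Variables (n : option nat) (phi : vertex n -> S) (b : bool) (e : nat -> space).
Hypothesis fr : frame m phi b e.

Definition valid i := (1 <= i)%N && Defs.le_inf i n.

Lemma valid_val (v : vertex n) : valid (val v).
Proof. by case: v. Qed.

Lemma valid_leq i j : (1 <= i)%N -> (i <= j)%N -> valid j -> valid i.
Proof. by move=> i1 ij /andP[_ jn]; rewrite /valid i1 (le_inf_leq ij). Qed.

Lemma valid2 : valid 2.
Proof. by have [n2 _ _ _ _] := fr; rewrite /valid n2. Qed.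

Lemma valid1 : valid 1.
Proof. exact: valid_leq valid2. Qed.

Lemma fm_frame i j : valid i -> valid j -> fm (e i) (e j) = (i == j)%:R.
Proof. by have [_ _ h _ _] := fr => /andP[? ?] /andP[? ?]; apply: h. Qed.

(** Indexing by numbers, with the value 1 out of range, lets the recursive words [flip] and [flips]
    do without bounds. *)
Definition vgen (psi : vertex n -> S) (i : nat) : W :=
  if insub i is Some v then gen (psi v) else 1%g.

Lemma vgenE psi (v : vertex n) : vgen psi (val v) = gen (psi v).
Proof. by rewrite /vgen valK. Qed.

Local Notation g := (vgen phi).

Lemma vgen_sq i : (g i * g i = 1)%g.
Proof. by rewrite /vgen; case: insub => [v|]; rewrite ?mulg1// (gen_sq WS). Qed.

Lemma rho_vgen i x : (2 <= i)%N -> valid i -> rho (g i) x =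
  x - fm x (e i - e i.-1) *: (e i - e i.-1).
Proof.
move=> i2 iv; have [_ _ _ _ r2] := fr; pose v : vertex n := exist _ i iv.
by rewrite -[i]/(val v) vgenE rho_gen /reflection r2.
Qed.

Lemma rho_vgen_swap i : (2 <= i)%N -> valid i ->
  [/\ rho (g i) (e i) = e i.-1, rho (g i) (e i.-1) = e i &
    forall k, valid k -> k != i -> k != i.-1 -> rho (g i) (e k) = e k].
Proof.
move=> i2 iv; have i1v : valid i.-1 by apply: valid_leq iv; lia.
have [ii1 i1i] : (i == i.-1) = false /\ (i.-1 == i) = false by split; lia.
split=> [||k kv ki ki1]; rewrite rho_vgen// !fmE !fm_frame// ?eqxx ?ii1 ?i1i.
- by rewrite subr0 scale1r opprB addrC subrK.
- by rewrite sub0r scaleN1r opprK addrC subrK.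
- by rewrite (negPf ki) (negPf ki1) subrr scale0r subr0.
Qed.

Lemma rho_vgen1 x : rho (g 1) x =
  x - fm x (coef1 R b *: e 1%N + coef2 R b *: e 2%N) *:
    (coef1 R b *: e 1%N + coef2 R b *: e 2%N).
Proof.
have [_ _ _ r1 _] := fr; pose v : vertex n := exist _ 1%N valid1.
by rewrite -[X in vgen _ X]/(val v) vgenE rho_gen /reflection r1.
Qed.

Definition opp_if (s : bool) (x : space) := if s then - x else x.

Lemma rho_opp_if w s x : rho w (opp_if s x) = opp_if s (rho w x).
Proof. by case: s; rewrite /= ?rhoN. Qed.
Lemma opp_if_opp_if s t x : opp_if s (opp_if t x) = opp_if (s (+) t) x.
Proof. by case: s; case: t; rewrite //= opprK. Qed.

Lemma rho_vgen1B k : b -> valid k -> rho (g 1) (e k) = opp_if (k == 1%N) (e k).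
Proof.
move=> bT kv; have s2 : Num.sqrt 2 * Num.sqrt 2 = 2 :> R by rewrite -expr2 sqr_sqrtr.
rewrite rho_vgen1 /coef1 /coef2 bT scale0r addr0 fmE fm_frame ?valid1// scalerA.
rewrite mulrAC s2; case: eqP => [->|_] /=; last by vring.
by vring.
Qed.

Lemma rho_vgen1D : ~~ b -> [/\ rho (g 1) (e 1%N) = - e 2%N, rho (g 1) (e 2%N) = - e 1%N &
  forall k, valid k -> k != 1%N -> k != 2%N -> rho (g 1) (e k) = e k].
Proof.
move=> /negPf bF; split=> [||k kv k1 k2];
  rewrite rho_vgen1 /coef1 /coef2 bF !fmE !fm_frame ?valid1 ?valid2//=; try by vring.
by rewrite (negPf k1) (negPf k2) !mulr0 addr0 scale0r subr0.
Qed.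

Lemma frame_faithful v w : (forall i, valid i -> rho v (e i) = rho w (e i)) -> v = w.
Proof.
move=> vw; have [_ [h hK Kh] _ r1 r2] := fr.
apply: (rho_faithful (R := R) (WS := WS)) => s; rewrite -(Kh s).
have sv := valid_val (h s); have [s1|s1] := eqVneq (val (h s)) 1%N.
  by rewrite r1// !rhoE !vw ?valid1 ?valid2.
have s2 : (2 <= val (h s))%N by move: sv => /andP[? _]; lia.
by rewrite r2// !rhoE !vw//; apply: valid_leq sv; lia.
Qed.

Lemma rho_flip i k : valid i -> valid k ->
  rho (flip b g i) (e k) = opp_if ((k == i) (+) (~~ b && (k == 1%N))) (e k).
Proof.
elim: i k => [|i IH] k iv kv; first by case/andP: iv.
case: i IH iv => [|i] IH iv.
  rewrite flip1E; case bE : b => /=; first by rewrite rho_vgen1B// addbF.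
  by rewrite rho1 addbb.
have i2 : (2 <= i.+2)%N by [].
have [si si1 sk] := rho_vgen_swap i2 iv.
have i1v : valid i.+1 by apply: valid_leq iv.
have conj : (1 <= i)%N || b -> rho (g i.+2 * flip b g i.+1 * g i.+2)%g (e k) =
    opp_if ((k == i.+2) (+) (~~ b && (k == 1%N))) (e k).
  move=> bi; rewrite !rhoM.
  have [->|ki] := eqVneq k i.+2.
    rewrite si IH// rho_opp_if si1 /= eqxx; congr (opp_if _ _).
    by move: bi; case: (b) => //=; rewrite orbF; case: (i).
  have [->|ki1] := eqVneq k i.+1.
    rewrite -[i.+1]/(i.+2.-1) si1 IH// rho_opp_if si; congr (opp_if _ _).
    rewrite /=; move: bi; case: (b) => //=; rewrite ?orbF ?addbF; first by lia.
    by case: (i) => //= j _; lia.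
  rewrite sk// IH// rho_opp_if sk//; congr (opp_if _ _).
  by rewrite (negPf ki1).
case: i conj {IH} si si1 sk iv i1v i2 => [|i] conj si si1 sk iv i1v i2.
  rewrite flip2E; case bE : b conj => /= conj; first by rewrite -conj.
  have [d1 d2 dk] : [/\ rho (g 1) (e 1%N) = - e 2%N, rho (g 1) (e 2%N) = - e 1%N &
    forall k, valid k -> k != 1%N -> k != 2%N -> rho (g 1) (e k) = e k].
    by apply: rho_vgen1D; rewrite bE.
  rewrite rhoM; have [->|k1] := eqVneq k 1%N; first by rewrite si1 d2.
  have [->|k2] := eqVneq k 2%N; first by rewrite si d1.
  by rewrite sk// dk.
by rewrite flipSE -conj.
Qed.

(** In type D the first coordinate changes sign once for each index from 2 to [k], so it is negated
    exactly when [k] is even. *)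
Lemma rho_flips k l : valid k -> valid l ->
  rho (flips b g k) (e l) = opp_if ((l <= k)%N (+) [&& ~~ b, l == 1%N & odd k]) (e l).
Proof.
elim: k => [|k IH] kv lv; first by case/andP: kv.
have l1 : (1 <= l)%N by case/andP: lv.
rewrite flipsS rhoM rho_flip// rho_opp_if.
have [->|k0] := eqVneq k 0%N.
  rewrite rho1; congr (opp_if _ _).
  by case: (b) => /=; case: (l) l1 => [|[|]].
have k1v : valid k by apply: valid_leq kv; lia.
rewrite IH// opp_if_opp_if; congr (opp_if _ _).
have -> : (l <= k.+1)%N = (l == k.+1) (+) (l <= k)%N by lia.
rewrite /=; case: (b) => /=; first by rewrite !addbF.
by case: (l == 1%N); case: (l == k.+1); case: (l <= k)%N; case: (odd k).
Qed.

Lemma simple_cases s : exists2 i, valid i & gen s = g i.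
Proof.
have [_ [h hK Kh] _ _ _] := fr; exists (val (h s)); first exact: valid_val.
by rewrite vgenE Kh.
Qed.

Lemma rho_vgen_frame i k : valid i -> valid k ->
  exists2 j, valid j & exists s, rho (g i) (e k) = opp_if s (e j).
Proof.
move=> iv kv; have [i1|i1] := eqVneq i 1%N.
  rewrite i1; case bE : b; first by exists k => //; exists (k == 1%N); apply: rho_vgen1B.
  have [|d1 d2 dk] := rho_vgen1D; first by rewrite bE.
  have [->|k1] := eqVneq k 1%N; first by exists 2%N; [exact: valid2|exists true].
  have [->|k2] := eqVneq k 2%N; first by exists 1%N; [exact: valid1|exists true].
  by exists k => //; exists false; apply: dk.
have i2 : (2 <= i)%N by case/andP: iv => ? _; lia.
have [si si1 sk] := rho_vgen_swap i2 iv.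
have i1v : valid i.-1 by apply: valid_leq iv; lia.
have [->|ki] := eqVneq k i; first by exists i.-1 => //; exists false.
have [->|ki1] := eqVneq k i.-1; first by exists i => //; exists false.
by exists k => //; exists false; apply: sk.
Qed.

Lemma rho_frame w k : valid k -> exists2 j, valid j & exists s, rho w (e k) = opp_if s (e j).
Proof.
move=> kv; elim/(coxeter_ind WS): w => [|s w [j jv [t wE]]].
  by exists k => //; exists false; rewrite rho1.
have [i iv ->] := simple_cases s; rewrite rhoM wE rho_opp_if.
have [l lv [u ->]] := rho_vgen_frame iv jv.
by exists l => //; exists (t (+) u); rewrite opp_if_opp_if.
Qed.

Definition diag : set W := fun w =>
  forall i, valid i -> exists s, rho w (e i) = opp_if s (e i).

Lemma diag_normal : normal_subgroup diag.
Proof.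
split; first split.
- by move=> i _; exists false; rewrite rho1.
- move=> x y dx dy i iv; have [s sE] := dx i iv; have [t tE] := dy i iv.
  by exists (t (+) s); rewrite rhoM tE rho_opp_if sE opp_if_opp_if.
- move=> x dx i iv; have [s sE] := dx i iv; exists s.
  by apply: (can_inj (rhoK WS x)); rewrite rhoVK rho_opp_if sE opp_if_opp_if addbb.
- move=> x w dx i iv; have [j jv [t wE]] := rho_frame w iv; have [s sE] := dx j jv.
  exists s; rewrite /conjg !rhoM wE rho_opp_if sE rho_opp_if rho_opp_if.
  apply: (can_inj (rhoK WS w)); rewrite !rho_opp_if rhoVK wE !opp_if_opp_if.
  by rewrite addbC.
Qed.

Lemma diag_abelian x y : diag x -> diag y -> commute x y.
Proof.
move=> dx dy; apply: frame_faithful => i iv.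
have [s sE] := dx i iv; have [t tE] := dy i iv.
by rewrite !rhoM sE tE !rho_opp_if sE tE !opp_if_opp_if addbC.
Qed.

Lemma diag_flips k : valid k -> diag (flips b g k).
Proof. by move=> kv l lv; eexists; apply: rho_flips. Qed.

Lemma parabolic_vgen i k : (i <= k)%N -> parabolic gen (phi @` initial n k)%classic (g i).
Proof.
move=> ik; rewrite /vgen; case: insubP => [v _ vi|_].
  apply: sub_generated; exists (phi v) => //; exists v => //.
  by rewrite /initial /= vi.
by have [] := generated_subgroup [set gen x | x in (phi @` initial n k)]%classic.
Qed.

Lemma parabolic_flips k : parabolic gen (phi @` initial n k)%classic (flips b g k).
Proof.
have [G1 GM _] := generated_subgroup [set gen x | x in (phi @` initial n k)]%classic.
have par i : (i <= k)%N -> parabolic gen (phi @` initial n k)%classic (g i).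
  exact: parabolic_vgen.
have fp i : (i <= k)%N -> parabolic gen (phi @` initial n k)%classic (flip b g i).
  elim: i => [|[|[|i]] IH] ik; first exact: G1.
  - by rewrite flip1E; case: (b); [apply: par|apply: G1].
  - have p1 : parabolic gen (phi @` initial n k)%classic (g 1%N).
      by apply: par; apply: ltnW.
    rewrite flip2E; case: (b) IH => IH; last by apply: GM => //; apply: par.
    by apply: (GM _ _); [apply: (GM _ _); [apply: par|apply: IH; apply: ltnW]|apply: par].
  - rewrite flipSE.
    by apply: (GM _ _); [apply: (GM _ _); [apply: par|apply: IH; apply: ltnW]|apply: par].
suff h i : (i <= k)%N -> parabolic gen (phi @` initial n k)%classic (flips b g i).
  exact: h.
elim: i => [|i IH] ik; first exact: G1.
by rewrite flipsS; apply: (GM _ _); [apply: IH; apply: ltnW|apply: fp].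
Qed.

(** Under the parity condition the word negates all of the first [k] frame vectors, hence the simple
    roots in question, and [longest_eltE] applies. *)
Lemma longest_flips k : valid k -> b || ~~ odd k ->
  longest_elt gen (phi @` initial n k)%classic = flips b g k.
Proof.
move=> kv bk; apply: (longest_eltE (R := R) (WS := WS) (@parabolic_flips k)).
move=> s [v]; rewrite /initial /= => vk <-.
have zE l : (1 <= l)%N -> (l <= k)%N -> rho (flips b g k) (e l) = - e l.
  move=> l1 lk; rewrite rho_flips// ?lk ?(valid_leq _ lk)//.
  by move: bk; case: (b) => //= /negPf ->; rewrite andbF.
have [_ _ _ r1 r2] := fr; have vv := valid_val v.
have [v1|v1] := eqVneq (val v) 1%N; last first.
  have v2 : (2 <= val v)%N by case/andP: vv => ? _; lia.
  have i1 : (1 <= (val v).-1)%N by case: (val v) v2 => [|[]].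
  have i2 : ((val v).-1 <= k)%N by apply: leq_trans (leq_pred _) vk.
  have i3 : (1 <= val v)%N by apply: ltnW.
  by rewrite r2// !rhoE !zE//; vring.
rewrite r1// !rhoE zE//; last by rewrite v1 in vk.
(* For [k = 1] the vector [e 2] is not negated, but this happens only in type B, where its
   coefficient is 0. *)
have [c2|k2] : coef2 R b = 0 \/ (2 <= k)%N.
    move: bk vk; rewrite v1 /coef2; case: (b) => /=; first by left.
    by case: (k) => [|[|]] //; right.
  by rewrite c2 !scale0r !addr0 scalerN.
by rewrite zE//; vring.
Qed.

Definition pure (p : W) := forall i, valid i -> exists2 j, valid j & rho p (e i) = e j.

(* Modulo sign changes generated by conjugates of [c], the group is generated
   by permutations of the frame. *)
Lemma diag_sub (N : set W) : subgroup N -> (N `<=` diag)%classic ->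
  (forall p, pure p -> N (p^-1 * (if b then g 1%N else g 1%N * g 2%N) * p)%g) ->
  (diag `<=` N)%classic.
Proof.
set c := (if b then _ else _) => -[N1 NM NV] Nd Nc.
have pure_mul i p : (2 <= i)%N -> valid i -> pure p -> pure (g i * p)%g.
  move=> i2 iv pp k kv; have [j jv pE] := pp k kv; rewrite rhoM pE.
  have [si si1 sk] := rho_vgen_swap i2 iv.
  have i1v : valid i.-1 by apply: valid_leq iv; lia.
  have [->|ji] := eqVneq j i; first by exists i.-1.
  have [->|ji1] := eqVneq j i.-1; first by exists i.
  by exists j => //; apply: sk.
have decomp w : exists p v, [/\ pure p, N v & w = (p * v)%g].
  elim/(coxeter_ind WS): w => [|s w [p [v [pp Nv ->]]]].
    by exists 1%g, 1%g; split=> //; rewrite ?mulg1// => i iv; exists i; rewrite ?rho1.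
  have [i iv ->] := simple_cases s; have [i1|i1] := eqVneq i 1%N; last first.
    exists (g i * p)%g, v; split=> //; last by rewrite mulgA.
    by apply: pure_mul => //; case/andP: iv => ? _; lia.
  (* In type D, [g 1] equals [c * g 2]: the factor [g 2] joins the permutation, and [c] moves past
     it as a conjugate. *)
  pose q := (if b then p else g 2%N * p)%g.
  have pq : pure q by rewrite /q; case: (b) => //; apply: pure_mul => //; exact: valid2.
  exists q, (q^-1 * c * q * v)%g; split=> //; first by apply: NM => //; apply: Nc.
  rewrite i1 !mulgA mulgV mul1g /q /c; case: (b) => //.
  by rewrite !mulgA -(mulgA (g 1%N) (g 2%N)) vgen_sq mulg1.
move=> w dw; have [p [v [pp Nv wE]]] := decomp w.
(* As [w] and [v] are sign changes, so is [p]; being also a permutation of the frame, it is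
   trivial. *)
suff p1 : p = 1%g by rewrite wE p1 mul1g.
have [[_ dM dV] _] := diag_normal.
have dp : diag p.
  by rewrite -(mulgK v p) -wE; apply: dM => //; apply/dV/Nd.
apply: frame_faithful => i iv; rewrite rho1.
have [s sE] := dp i iv; have [j jv pE] := pp i iv.
have ij : i == j.
  have : fm (opp_if s (e i)) (e j) = 1 by rewrite -sE pE fm_frame// eqxx.
  by case: (s); rewrite /= ?fmNl fm_frame//; case: eqP => //= _; lra.
by rewrite pE (eqP ij).
Qed.

(** Quotients of successive longest elements are the single sign changes, and a conjugate of [g 1]
    by a permutation is one of them. *)
Lemma GB_diag : b -> GB gen phi = diag.
Proof.
move=> bT; have [[d1 dM dV] _] := diag_normal.
have [G1 GM GV] := generated_subgroup
  [set longest_elt gen (phi @` initial n k)%classic | k in [set k | valid k]]%classic.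
have fE k : valid k -> longest_elt gen (phi @` initial n k)%classic = flips b g k.
  by move=> kv; apply: longest_flips; rewrite ?bT.
have Gflips k : valid k -> GB gen phi (flips b g k).
  by move=> kv; apply: sub_generated; exists k; rewrite // fE.
have Gd : (GB gen phi `<=` diag)%classic.
  move=> x; elim/generated_ind => // _ [k kv <-]; rewrite fE//; exact: diag_flips.
apply/seteqP; split=> //; apply: (@diag_sub (GB gen phi)) => // p pp.
rewrite bT.
have Gflip j : valid j -> GB gen phi (flip b g j).
  case: j => [/andP[]//|[|j]] jv; first by have := Gflips 1%N jv; rewrite flipsS mul1g.
  have -> : flip b g j.+2 = ((flips b g j.+1)^-1 * flips b g j.+2)%g by rewrite flipsS mulKg.
  by apply: GM; [apply: GV; apply: Gflips; apply: valid_leq jv|apply: Gflips].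
have [j jv [s pV]] := rho_frame p^-1%g valid1.
have [l lv pj] := pp j jv.
have e1E : e 1%N = opp_if s (e l) by rewrite -(rhoVK WS p (e 1%N)) pV rho_opp_if pj.
have sF : s = false.
  have := fm_frame valid1 valid1; rewrite {1}e1E; case: (s) => //=.
  by rewrite fmNl fm_frame ?valid1//; case: eqP => //= _; lra.
rewrite sF /= in pV e1E.
suff -> : (p^-1 * g 1%N * p = flip b g j)%g by apply: Gflip.
apply: frame_faithful => i iv; rewrite !rhoM.
have [k kv pi] := pp i iv; rewrite pi rho_vgen1B// rho_opp_if rho_flip// bT /= addbF.
have ki : (k == 1%N) = (i == j).
  have p1 : rho p (e j) = e 1%N by rewrite -pV rhoVK.
  have := fm_rho WS p (e i) (e j); rewrite pi p1 !fm_frame ?valid1//.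
  by move=> /eqP; rewrite eqr_nat; case: (k == 1%N); case: (i == j).
by rewrite ki -(rhoK WS p (e i)) pi.
Qed.

(** The generator for [k = 1] is [g 1 * g 2] itself, and normality supplies its conjugates. *)
Lemma GD_diag : ~~ b -> GD gen phi = diag.
Proof.
move=> bF; have dn := diag_normal.
have fE k : valid k.*2 -> longest_elt gen (phi @` initial n k.*2)%classic = flips b g k.*2.
  by move=> kv; apply: longest_flips => //; rewrite odd_double orbT.
have Gd : (GD gen phi `<=` diag)%classic.
  move=> x h; apply: h; split=> // _ [k /andP[k1 kn] <-].
  have kv : valid k.*2 by rewrite /valid kn andbT double_gt0.
  by rewrite fE//; apply: diag_flips.
apply/seteqP; split=> //; apply: (@diag_sub (GD gen phi)) => // [|p pp].
  by have [] := normal_closure_normal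
    [set longest_elt gen (phi @` initial n k.*2)%classic
      | k in [set k | (1 <= k)%N && Defs.le_inf k.*2 n]]%classic.
rewrite (negPf bF) -mulgA.
have [_ NJ] := normal_closure_normal
  [set longest_elt gen (phi @` initial n k.*2)%classic
    | k in [set k | (1 <= k)%N && Defs.le_inf k.*2 n]]%classic.
apply: NJ; apply: sub_normal_closure; exists 1%N.
  exact: valid2.
rewrite (fE 1%N) ?valid2// !flipsS flip1E flip2E (negPf bF).
by rewrite mul1g mul1g.
Qed.

Lemma frame_swap d i : (1 <= d)%N -> valid i -> valid (i + d)%N ->
  exists w, rho w (e i) = e (i + d)%N /\
    forall k, valid k -> k != i -> k != (i + d)%N -> rho w (e k) = e k.
Proof.
elim: d => // d IH _ iv idv; have i1 : (1 <= i)%N by case/andP: iv.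
have k2 : (2 <= i + d.+1)%N by lia.
have [si si1 sk] := rho_vgen_swap k2 idv; rewrite addnS /= in si si1 sk idv *.
have idv' : valid (i + d)%N by apply: valid_leq idv; lia.
have [d0|d0] := eqVneq d 0%N.
  rewrite d0 addn0 in si1 sk *; exists (g i.+1); split=> // k kv ki ki1.
  exact: sk.
have [|w [wi wk]] := IH _ iv idv'; first by lia.
have ii : i != (i + d).+1 /\ i != (i + d)%N by split; lia.
exists (g (i + d).+1 * w * g (i + d).+1)%g; split=> [|k kv ki kid].
  by rewrite !rhoM sk ?wi ?si1//; case: ii.
rewrite !rhoM; have [->|kd] := eqVneq k (i + d)%N.
  by rewrite si1 wk ?si//; lia.
by rewrite sk// wk// sk.
Qed.

Lemma frame_swap_neq i j : valid i -> valid j -> i != j ->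
  exists w, rho w (e i) = e j /\
    forall k, valid k -> k != i -> k != j -> rho w (e k) = e k.
Proof.
move=> iv jv; wlog ij : i j iv jv / (i < j)%N.
  move=> h ij; have [lt|lt] : (i < j)%N \/ (j < i)%N by lia.
    by apply: h.
  have [|w [wj wk]] := h j i jv iv lt; first by rewrite eq_sym.
  exists w^-1%g; rewrite -wj rhoK; split=> // k kv ki kj.
  by apply: (can_inj (rhoK WS w)); rewrite rhoVK wk.
move=> _; have jE : j = (i + (j - i))%N by lia.
have [||w h] := @frame_swap (j - i) i _ iv; rewrite -?jE//; first by lia.
by exists w; rewrite {1 2}jE.
Qed.

(** If [w] centralizes [H] and sends [e i] to plus or minus [e j] with [j] different from [i], every
    element of [H] has the same sign at [i] and [j]. Conjugating by swaps of [j] with other indices,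
    which fix [e i], makes all signs equal, so [H] would act by scalars and be central. *)
Lemma centralizer_diag (H : set W) : normal_subgroup H ->
  ~ (H `<=` Defs.center W)%classic -> (H `<=` diag)%classic ->
  centralizer H = diag.
Proof.
move=> [_ HJ] ncH Hd; apply/seteqP; split=> [w wH i iv|w dw h Hh]; last first.
  exact: diag_abelian (Hd h Hh).
have [j jv [s wE]] := rho_frame w iv; have [ij|ij] := eqVneq i j.
  by rewrite ij in wE *; exists s.
exfalso; apply: ncH => h Hh.
have opp_ifK t : involutive (opp_if t).
  by move=> x; rewrite opp_if_opp_if addbb.
have same x t : H x -> rho x (e i) = opp_if t (e i) -> rho x (e j) = opp_if t (e j).
  move=> Hx xi; apply: (can_inj (opp_ifK s)); rewrite -rho_opp_if -wE -rhoM.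
  by rewrite -(wH x Hx) rhoM xi rho_opp_if wE !opp_if_opp_if addbC.
have [t hi] := Hd h Hh i iv.
have all l : valid l -> rho h (e l) = opp_if t (e l).
  move=> lv; have [->|li] := eqVneq l i; first exact: hi.
  have [->|lj] := eqVneq l j; first exact: same.
  have [|v [vl vk]] := frame_swap_neq jv lv; first by rewrite eq_sym.
  have vi : rho v (e i) = e i by apply: vk; rewrite // eq_sym.
  have xi : rho (v^-1 * (h * v))%g (e i) = opp_if t (e i).
    by rewrite !rhoM vi hi rho_opp_if -{1}vi rhoK.
  have := same _ t (HJ h v Hh) xi; rewrite /conjg !rhoM vl => hl.
  by rewrite -vl -rho_opp_if -hl rhoVK vl.
have [_ [f fK Kf] _ r1 r2] := fr.
apply: (central_scale (R := R) (WS := WS) (e := if t then -1 else 1)) => u.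
have optE x : opp_if t x = (if t then -1 else 1) *: x.
  by case: (t); rewrite /= ?scaleN1r ?scale1r.
rewrite -(Kf u); have sv := valid_val (f u); have [s1|s1] := eqVneq (val (f u)) 1%N.
  by rewrite r1// !rhoE !all ?valid1 ?valid2// !optE; vring.
have s2 : (2 <= val (f u))%N by move: sv => /andP[? _]; lia.
have s1v : valid (val (f u)).-1 by apply: valid_leq sv; lia.
by rewrite r2// !rhoE !all// !optE; vring.
Qed.

End SignChanges.

(** * Images of generated subgroups and of normal closures *)

Section Images.
Variables (G G' : groupType) (f : {multiplicative G -> G'}).

Lemma image_generated (A : set G) :
  (f @` generated A = generated (f @` A))%classic.
Proof.
have [g1 gM gV] := generated_subgroup A.
have [h1 hM hV] := generated_subgroup (f @` A)%classic.
apply/seteqP; split=> [_ [x + <-]|x].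
  elim/generated_ind => [|y z fy fz|y fy|y Ay].
  - by rewrite multiplicative1.
  - by rewrite gmulfM; apply: hM.
  - by rewrite multiplicativeV; apply: hV.
  - by apply: sub_generated; exists y.
elim/generated_ind => [|_ _ [y gy <-] [z gz <-]|_ [y gy <-]|_ [y Ay <-]].
- by exists 1%g; rewrite // multiplicative1.
- by exists (y * z)%g; rewrite ?gmulfM//; apply: gM.
- by exists y^-1%g; rewrite ?multiplicativeV//; apply: gV.
- by exists y => //; apply: sub_generated.
Qed.

Lemma image_normal_closure (A : set G) : (forall y, exists x, f x = y) ->
  (f @` normal_closure A = normal_closure (f @` A))%classic.
Proof.
move=> fsurj; have [[g1 gM gV] gJ] := normal_closure_normal A.
have [[h1 hM hV] hJ] := normal_closure_normal (f @` A)%classic.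
apply/seteqP; split=> [_ [x xA <-]|y yA].
  apply: (xA [set x | normal_closure (f @` A) (f x)]%classic); split; last by move=> y Ay; apply: sub_normal_closure; exists y.
  split; first split=> [|y z hy hz|y hy]; rewrite /mkset.
  - by rewrite multiplicative1.
  - by rewrite gmulfM; apply: hM.
  - by rewrite multiplicativeV; apply: hV.
  - by move=> y w hy; rewrite /mkset /conjg !gmulfM multiplicativeV; apply: hJ.
apply: (yA (f @` normal_closure A)%classic); split; last by move=> _ [x Ax <-]; exists x => //; apply: sub_normal_closure.
split; first split=> [|_ _ [x gx <-] [z gz <-]|_ [x gx <-]].
- by exists 1%g; rewrite // multiplicative1.
- by exists (x * z)%g; rewrite ?gmulfM//; apply: gM.
- by exists x^-1%g; rewrite ?multiplicativeV//; apply: gV.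
- move=> _ w [x gx <-]; have [v <-] := fsurj w; exists (x ^ v)%g; first exact: gJ.
  by rewrite /conjg !gmulfM multiplicativeV.
Qed.

End Images.

(** * Centralizers *)

Section Conclusion.
Variables (R : realType) (S : Type) (m : S -> S -> option nat).
Variables (W : groupType) (gen : S -> W).
Hypothesis WS : coxeter_system m gen.
Hypothesis irr : irreducible m.

Local Notation space := (free R {classic (S + S)}).

Definition GBD (b : bool) n (phi : vertex n -> S) : set W :=
  if b then GB gen phi else GD gen phi.

Lemma GBD_diag n (phi : vertex n -> S) b (e : nat -> space) :
  frame m phi b e -> GBD b phi = diag WS n e.
Proof.
move=> fr; rewrite /GBD; have [bb|bb] := boolP b; first exact: GB_diag fr bb.
exact: GD_diag fr bb.
Qed.

Lemma graph_iso_comp n (phi : vertex n -> S) (tau : vertex n -> vertex n) M :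
  graph_iso M m phi -> graph_iso M M tau -> graph_iso M m (phi \o tau).
Proof.
move=> [phib phiE phim] [taub tauE taum]; split; first exact: bij_comp.
  by move=> s t; rewrite /= phiE tauE.
by move=> s t st; rewrite /= phim ?taum//; apply/tauE.
Qed.

(** A graph automorphism merely replaces the identification [phi] by [phi \o tau], so the image is
    the group of sign changes of another frame. The automorphisms, such as those of D_4, need not be
    listed. *)
Lemma image_GBD n (phi : vertex n -> S) tau (f : {multiplicative W -> W}) b :
  Defs.le_inf 2 n -> graph_iso (mat_bd b (n := n)) m phi ->
  graph_iso (mat_bd b (n := n)) (mat_bd b (n := n)) tau -> Defs.induced gen phi tau f ->
  exists e : nat -> space, frame m (phi \o tau) b e /\
    (f @` GBD b phi)%classic = diag WS n e.
Proof.
move=> n2 phii taui ind.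
have phim := iso_matrix WS phii; have phib : bijective phi by have [] := phii.
have phii' := graph_iso_comp phii taui.
have phim' := iso_matrix WS phii'; have phib' : bijective (phi \o tau) by have [] := phii'.
have [e fr] := matrix_frame R WS n2 phib phim.
have [e' fr'] := matrix_frame R WS n2 phib' phim'.
exists e'; split=> //; rewrite -(GBD_diag fr').
have fg i : f (vgen gen phi i) = vgen gen (phi \o tau) i.
  by rewrite /vgen; case: insub => [v|]; [apply: ind|apply: multiplicative1].
have fE k : valid n k -> b || ~~ odd k -> f (longest_elt gen (phi @` initial n k)%classic) =
    longest_elt gen ((phi \o tau) @` initial n k)%classic.
  move=> kv bk; rewrite (longest_flips WS fr kv bk) (longest_flips WS fr' kv bk).
  exact: flips_morph.
have fsurj y : exists x, f x = y.
  have : generated (range gen) y by rewrite (cox_gen WS).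
  elim/generated_ind => [|_ _ [u <-] [v <-]|_ [u <-]|_ [s _ <-]].
  - by exists 1%g; rewrite multiplicative1.
  - by exists (u * v)%g; rewrite gmulfM.
  - by exists u^-1%g; rewrite multiplicativeV.
  - by have [h _ hK] := phib'; exists (gen (phi (h s))); rewrite ind -[in RHS](hK s).
rewrite /GBD; case: (b) fE => fE.
  rewrite /GB image_generated; congr generated; apply/seteqP.
  by split=> [_ [_ [k kv <-] <-]|_ [k kv <-]]; [exists k|
    exists (longest_elt gen (phi @` initial n k)%classic)] => //; rewrite ?fE//; exists k.
rewrite /GD image_normal_closure//; congr normal_closure; apply/seteqP.
have kvE k : ((1 <= k)%N && Defs.le_inf k.*2 n) -> valid n k.*2.
  by move=> /andP[k1 kn]; rewrite /valid kn andbT double_gt0.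
split=> [_ [_ [k kv <-] <-]|_ [k kv <-]].
  by exists k; rewrite // fE ?odd_double//; apply: kvE.
exists (longest_elt gen (phi @` initial n k.*2)%classic); first by exists k.
by rewrite fE ?odd_double//; apply: kvE.
Qed.

Lemma centralizer_normal (H : set W) : normal_subgroup H -> normal_subgroup (centralizer H).
Proof.
move=> [[_ _ HV] HJ]; split; first split.
- by move=> h _; apply/commute_sym/commute1.
- by move=> x y cx cy h Hh; apply/commute_sym/commuteM; apply/commute_sym; [apply: cx|apply: cy].
- by move=> x cx h Hh; apply/commute_sym/commuteV/commute_sym/cx.
move=> x w cx h Hh.
have := cx _ (HJ h w^-1%g Hh); rewrite /commute /conjg invgK => e.
apply: (mulgI w); apply: (mulIg w^-1%g).
by rewrite !mulgA mulgV mul1g in e *; rewrite -!mulgA in e *; rewrite mulgV mulg1.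
Qed.

Lemma diagonalizable_frame (H : set W) : normal_subgroup H ->
  diagonalizable R WS H -> ~ (H `<=` Defs.center W)%classic ->
  exists n (phi : vertex n -> S) b (e : nat -> space), frame m phi b e /\
    (H `<=` diag WS n e)%classic.
Proof.
move=> nH dH ncH; have [n [phi [b [e [fr eig]]]]] := exists_frame nH irr dH ncH.
exists n, phi, b, e; split=> // h Hh i /andP[i1 iN].
by have [|] := eig i i1 iN h Hh => ->; [exists false|exists true].
Qed.

(** A root that is an eigenvector of [H] settles the matter directly. One for the centralizer puts
    the centralizer into a group of sign changes, which is then its own centralizer and so contains
    [H]. Without either, [moved_diagonalizable] applies. *)
Lemma noncentral_frame (H : set W) : normal_subgroup H -> generated_by_involutions H ->
  ~ (H `<=` Defs.center W)%classic -> ~ (centralizer H `<=` Defs.center W)%classic ->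
  exists n (phi : vertex n -> S) b (e : nat -> space), frame m phi b e /\
    (H `<=` diag WS n e)%classic.
Proof.
move=> nH invH ncH ncK; have nK := centralizer_normal nH.
have [[d [dr ed]]|nd] := pselect (exists d : space, isroot WS d /\ eigen WS H d).
  exact: diagonalizable_frame nH (eigen_root_diagonalizable nH irr dr ed) ncH.
have [[d [dr ed]]|nd'] := pselect (exists d : space, isroot WS d /\ eigen WS (centralizer H) d).
  have [n [phi [b [e [fr Kd]]]]] :=
    diagonalizable_frame nK (eigen_root_diagonalizable nK irr dr ed) ncK.
  exists n, phi, b, e; split=> // h Hh.
  rewrite -(centralizer_diag fr nK ncK Kd) => k Kk.
  exact/commute_sym/Kk.
apply: diagonalizable_frame => //; apply: (@moved_diagonalizable _ _ _ _ _ _ _ nH (centralizer H)) => //.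
- by move=> k h Kk Hh; apply: Kk.
- by move=> d dr ed; apply: nd; exists d.
- move=> d dr; apply: contrapT => nk; apply: nd'; exists d; split=> // k Kk.
  by apply: contrapT => kd; apply: nk; exists k => //; split=> h; apply: kd; [left|right].
Qed.

End Conclusion.

Import Rstruct Defs.
Local Open Scope classical_set_scope.
Local Open Scope group_scope.

Theorem theorem3p1 (S : Type) (m : S -> S -> option nat) (W : groupType)
    (gen : S -> W) (H : set W) (WS : coxeter_system m gen)
    (irrWS : irreducible m) (nH : normal_subgroup H)
    (invH : generated_by_involutions H) :
  [/\ (H `<=` center W -> centralizer H = setT),
      (forall (n : option nat) (phi : vertex n -> S)
          (tau : vertex n -> vertex n) (f : {multiplicative W -> W}),
        typeB m gen phi tau f ->
        ~ (H `<=` center W) -> H `<=` f @` GB gen phi ->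
        centralizer H = f @` GB gen phi),
      (forall (n : option nat) (phi : vertex n -> S)
          (tau : vertex n -> vertex n) (f : {multiplicative W -> W}),
        typeD m gen phi tau f ->
        ~ (H `<=` center W) -> H `<=` f @` GD gen phi ->
        centralizer H = f @` GD gen phi)
    & (~ (H `<=` center W) ->
       ~ (exists (n : option nat) (phi : vertex n -> S)
            (tau : vertex n -> vertex n) (f : {multiplicative W -> W}),
            typeB m gen phi tau f /\ H `<=` f @` GB gen phi) ->
       ~ (exists (n : option nat) (phi : vertex n -> S)
            (tau : vertex n -> vertex n) (f : {multiplicative W -> W}),
            typeD m gen phi tau f /\ H `<=` f @` GD gen phi) ->
       centralizer H = center W)].
Proof.
pose R : realType := Rdefinitions.R.
split.
- move=> Hc; apply/seteqP; split=> // w _ h Hh.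
  by apply/commute_sym; apply: Hc.
- move=> n phi tau f [n2 phii taui ind] ncH HG.
  rewrite -(mat_bdE true) in phii taui.
  have [e [fr fG]] := image_GBD R WS n2 phii taui ind.
  rewrite /GBD in fG; rewrite fG in HG *.
  exact: (@centralizer_diag R S m W gen WS n _ true e fr H nH ncH HG).
- move=> n phi tau f [n3 phii taui ind] ncH HG.
  rewrite -(mat_bdE false) in phii taui.
  have n2 : le_inf 2 n by apply: le_inf_leq n3.
  have [e [fr fG]] := image_GBD R WS n2 phii taui ind.
  rewrite /GBD in fG; rewrite fG in HG *.
  exact: (@centralizer_diag R S m W gen WS n _ false e fr H nH ncH HG).
move=> ncH nB nD; apply/seteqP; split=> [|w cw h _]; last exact: cw.
apply: contrapT => ncK.
have [n [phi [b [e [fr Hd]]]]] := @noncentral_frame R S m W gen WS irrWS H nH invH ncH ncK.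
have [n2 phib _ _ _] := fr.
have phii := matrix_iso phib (frame_matrix WS fr).
(* The frame already comes with an identification of the graph, so the identity serves as [tau]. *)
have idi M : graph_iso M M (id : vertex n -> vertex n) by split=> //; exists id.
have im (G : set W) : (idfun : {multiplicative W -> W}) @` G = G by apply: image_id.
have GE := GBD_diag WS fr; have n3 := frameD_rank WS irrWS _ fr.
case: b phii GE n3 {fr} => phii GE n3; rewrite mat_bdE /= in phii.
  apply: nB; exists n, phi, id, idfun; split; last by rewrite im [GB _ _]GE.
  by split.
apply: nD; exists n, phi, id, idfun; split; last by rewrite im [GD _ _]GE.
by split=> //; apply: n3.
Qed.
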